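(* Let $F$ be an instanton bundle on $\mathbb P^3$ with monad $$0\to W\otimes\mathcal O(-1)\xrightarrow{A}V\otimes\mathcal O\xrightarrow{A^{\ast}}W^{\ast}\otimes\mathcal O(1)\to0 .$$ Let $K$ be a vector bundle on $\mathbb P^3$ and suppose $f\in\operatorname{Hom}(W\otimes\mathcal O(-1),K)$ is mapped to $e\in H^1(F\otimes K)\cong\operatorname{Ext}^1(F,K)$ by the canonical homomorphism $$\operatorname{Hom}(W\otimes\mathcal O(-1),K)\cong H^1(F(-1))\otimes H^0(K(1))\to H^1(F\otimes K).$$ Then the monad $$0\to W\otimes\mathcal O(-1)\xrightarrow{\begin{pmatrix}A\\ f\end{pmatrix}}(V\otimes\mathcal O)\oplus K\xrightarrow{\begin{pmatrix}A^{\ast}&0\end{pmatrix}}W^{\ast}\otimes\mathcal O(1)\to0$$ defines a vector bundle $E$ which is the extension $0\to K\to E\to F\to0$ of $F$ by $K$ corresponding to the element $e\in\operatorname{Ext}^1(F,K)$.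
   Context: A monad is a complex of vector bundles $0\to\mathcal W_1\xrightarrow{A}\mathcal V\xrightarrow{B}\mathcal W_2\to0$ with $A$ injective and $B$ surjective as homomorphisms of vector bundles (fibrewise); the vector bundle it defines is $\operatorname{Ker}B/\operatorname{Im}A$. An instanton bundle here is a symplectic or orthogonal vector bundle $F$ on $\mathbb P^3$ (over $\mathbb C$) of rank $r$ which is trivial on some line and satisfies $H^1(F(-2))=0$; in particular $F\cong F^{\ast}$. By a theorem of Barth such an $F$ is given by a monad $0\to W\otimes\mathcal O(-1)\xrightarrow{A}V\otimes\mathcal O\xrightarrow{A^{\ast}}W^{\ast}\otimes\mathcal O(1)\to0$, where $W$, $V$ are vector spaces of dimensions $n$ and $2n+r$, $A$ is a $(2n+r)\times n$ matrix of linear forms of constant rank $n$ on $\mathbb P^3$, and $A^{\ast}$ is its dual (with $V\cong V^{\ast}$ via the symplectic or orthogonal structure). One has a canonical identification $W^{\ast}\cong H^1(F(-1))$ coming from the monad. *)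

(* Defs.v *)
From HB Require Import structures.
From mathcomp Require Import all_boot all_order all_algebra.
From mathcomp Require Import reals complex.
From mathcomp Require Import mpoly.

Set Implicit Arguments.
Unset Strict Implicit.
Unset Printing Implicit Defensive.

Import GRing.Theory.
Local Open Scope ring_scope.

(* Algebraic vector bundles on P^3 over an algebraically closed field k, in
   the classical language of varieties: a point is a line of k^4, a regular
   function is locally a quotient of forms of equal degree, and a vector
   bundle is a family of finite-dimensional fibres together with its regular
   sections, subject to local triviality.  Over such a k these are the
   locally free sheaves of finite rank on the scheme P^3.  H^1 is Cech
   cohomology with respect to arbitrary Zariski open covers (in degree 1 it
   coincides with sheaf cohomology on every space). *)

Section LinearAlgebra.
Variable k : fieldType.
Implicit Types U V T : vectType k.

Definition lin_dual V : vectType k := 'Hom(V, k^o).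

Definition bas V (j : 'I_(\dim {:V})) : V := (vbasis {:V})`_j.

Definition dbas V (j : 'I_(\dim {:V})) : lin_dual V :=
  linfun (coord (vbasis {:V}) j : V -> k^o).

(* MathComp has no tensor product of abstract vector spaces.  For finite
   dimensional spaces we realize U (x) V as Hom(V^*, U), with
   u (x) v := (eta |-> eta(v) u); see tens_universal below. *)
Definition tens U V : vectType k := 'Hom(lin_dual V, U).

Definition tns U V (u : U) (v : V) : tens U V :=
  linfun (fun eta : lin_dual V => eta v *: u).

(* The map on U (x) V induced by a bilinear b : U -> V -> T. *)
Definition tlift U V T (b : U -> V -> T) (t : tens U V) : T :=
  \sum_j b (t (dbas j)) (bas j).

Definition tmap U V U' V' (p : U -> U') (q : V -> V') :
    tens U V -> tens U' V' :=
  tlift (fun u v => tns (p u) (q v)).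

(* The quotient U / W of two subspaces W <= U of T, carried by MathComp's
   canonical complement of W in U. *)
Definition subquot T (U W : {vspace T}) : vectType k := subvs_of (U :\: W)%VS.

Definition sq_class T (U W : {vspace T}) : 'Hom(T, subquot U W) :=
  (linfun (vsproj (U :\: W)%VS : T -> subquot U W) \o addv_pi1 U W)%VF.

Lemma bas_expand V (v : V) : v = \sum_j dbas j v *: bas j.
Proof.
rewrite {1}(coord_vbasis (memvf v)); apply: eq_bigr => j _.
by rewrite /dbas lfunE.
Qed.

Lemma dual_expand V (eta : lin_dual V) : eta = \sum_j eta (bas j) *: dbas j.
Proof.
apply/lfunP => v; rewrite {1}(bas_expand v) linear_sum sum_lfunE.
by apply: eq_bigr => j _; rewrite linearZ scale_lfunE; exact: mulrC.
Qed.

Lemma tnsE U V (u : U) (v : V) (eta : lin_dual V) : tns u v eta = eta v *: u.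
Proof.
have lin : linear (fun eta : lin_dual V => eta v *: u).
  by move=> a b c; rewrite !lfunE /= !lfunE /= scalerDl scalerA.
pose f := GRing.isLinear.Build k (lin_dual V) U _ _ lin.
pose F : {linear lin_dual V -> U} := HB.pack (fun eta : lin_dual V => eta v *: u) f.
exact: (lfunE F).
Qed.

Lemma tens_expand U V (t : tens U V) : t = \sum_j tns (t (dbas j)) (bas j).
Proof.
apply/lfunP => eta; rewrite {1}(dual_expand eta) linear_sum sum_lfunE.
by apply: eq_bigr => j _; rewrite linearZ tnsE.
Qed.

Lemma tlift_tns U V T (b : U -> V -> T) (u : U) (v : V) :
    (forall v', linear (b^~ v')) -> (forall u', linear (b u')) ->
  tlift b (tns u v) = b u v.
Proof.
move=> bl br.
have bZl a u' v' : b (a *: u') v' = a *: b u' v'.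
  have b0 : b 0 v' = 0.
    by have := bl v' 1 0 0; rewrite !scale1r add0r => /(congr1 (+%R^~ (- b 0 v')));
      rewrite subrr addrK => <-.
  by have := bl v' a u' 0; rewrite !addr0 b0 addr0.
pose f := GRing.isLinear.Build k V T _ _ (br u).
pose B : {linear V -> T} := HB.pack (b u) f.
rewrite /tlift -[b u v]/(B v) {2}(bas_expand v) linear_sum.
by apply: eq_bigr => j _; rewrite tnsE bZl linearZ.
Qed.

Lemma tens_universal U V T (b : U -> V -> T) :
    (forall v, linear (b^~ v)) -> (forall u, linear (b u)) ->
  exists! beta : 'Hom(tens U V, T), forall u v, beta (tns u v) = b u v.
Proof.
move=> bl br.
have lin : linear (tlift b).
  move=> a s t; rewrite /tlift scaler_sumr -big_split; apply: eq_bigr => j _ /=.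
  by rewrite !lfunE /= !lfunE /= bl.
pose f := GRing.isLinear.Build k (tens U V) T _ _ lin.
pose B : {linear tens U V -> T} := HB.pack (tlift b) f.
exists (linfun B); split=> [u v | beta Hb]; first by rewrite lfunE /= tlift_tns.
apply/lfunP => t; rewrite lfunE /= [t in RHS]tens_expand linear_sum.
by apply: eq_bigr => j _; symmetry; apply: Hb.
Qed.

Lemma sq_class_onto T (U W : {vspace T}) (q : subquot U W) :
  exists2 u, u \in U & sq_class U W u = q.
Proof.
exists (vsval q); first by apply: (subvP (diffvSl U W)); apply: subvsP.
by rewrite /sq_class !lfunE /= lfunE /= daddv_pi_id ?subvsP ?vsvalK ?capv_diff.
Qed.

Lemma sq_class_eq0 T (U W : {vspace T}) (u : T) :
  (W <= U)%VS -> u \in U -> (sq_class U W u == 0) = (u \in W).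
Proof.
move=> WU Uu; rewrite /sq_class !lfunE /= lfunE /=.
have Uu' : u \in (U + W)%VS by rewrite (subvP (addvSl U W)).
have Eu := addv_pi1_pi2 Uu'.
apply/eqP/idP => [/(congr1 vsval) | Wu].
  by rewrite vsprojK ?memv_pi // linear0 => p0; rewrite -Eu p0 add0r memv_pi2.
have p2 : addv_pi2 U W u = u by apply: addv_pi2_id.
have p1 : addv_pi1 U W u = 0.
  by apply: (addIr (addv_pi2 U W u)); rewrite Eu add0r p2.
by rewrite p1 linear0.
Qed.

Inductive form_type := Symplectic | Orthogonal.

Definition form_symmetry V (ty : form_type) (q : 'Hom(V, lin_dual V)) : Prop :=
  match ty with
  | Symplectic => forall u, q u u = 0
  | Orthogonal => forall u v, q u v = q v u
  end.

End LinearAlgebra.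

Section ProjectiveSpace.
Variable k : closedFieldType.

Definition P3 := {x : {vspace 'rV[k]_4} | \dim x == 1%N}.

Definition ev (p : {mpoly k[4]}) (v : 'rV[k]_4) : k := p.@[fun i => v 0 i].

(* The complement of the common zeros of a set S of forms. *)
Definition zopen (N : P3 -> Prop) : Prop :=
  exists S : {mpoly k[4]} -> Prop,
    (forall p, S p -> exists d : nat, p \is d.-homog) /\
    (forall x, N x <->
       exists2 p, S p & forall v, v \in val x -> v != 0 -> ev p v != 0).

Definition near (x : P3) (P : P3 -> Prop) : Prop :=
  exists N, [/\ zopen N, N x & forall y, N y -> P y].

(* f is regular in a neighbourhood of x. *)
Definition regular_fun (f : P3 -> k) (x : P3) : Prop :=
  exists (d : nat) (g h : {mpoly k[4]}),
    [/\ g \is d.-homog, h \is d.-homog &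
        near x (fun y => forall v, v \in val y -> v != 0 ->
                           ev h v != 0 /\ f y = ev g v / ev h v)].

(* Fibres and regular sections, before local triviality is imposed.
   regular_at s x : the section s is regular in a neighbourhood of x (values
   away from x are irrelevant).  A section regular on an open set N is a
   family of vectors that is regular at every point of N. *)
Record prebundle := PreBundle {
  fiber :> P3 -> vectType k;
  regular_at : (forall x, fiber x) -> P3 -> Prop
}.

Definition section (G : prebundle) := forall x, G x.

Definition global_section (G : prebundle) (s : section G) : Prop :=
  forall x, regular_at s x.

Definition frame (G : prebundle) r (b : 'I_r -> section G) (x : P3) :
  r.-tuple (G x) := [tuple b i x | i < r].

(* G is a vector bundle of rank r: near each point there is a frame with
   respect to which the regular sections are those with regular
   coordinates. *)
Definition is_vbundle (r : nat) (G : prebundle) : Prop :=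
  forall x, exists b : 'I_r -> section G,
    near x (fun y =>
      basis_of {:G y} (frame b y) /\
      forall s : section G, regular_at s y <->
        forall i, regular_fun (fun z => coord (frame b z) i (s z)) y).

Definition vb_map (G H : prebundle) := forall x, 'Hom(G x, H x).

Definition is_morph (G H : prebundle) (p : vb_map G H) : Prop :=
  forall (s : section G) x,
    regular_at s x -> @regular_at H (fun y => p y (s y)) x.

Definition is_iso (G H : prebundle) (p : vb_map G H) : Prop :=
  [/\ is_morph p, forall x, lker (p x) = 0%VS, forall x, limg (p x) = fullv &
      @is_morph H G (fun x => (p x)^-1%VF)].

Definition short_exact (G' G G'' : prebundle)
    (i : vb_map G' G) (p : vb_map G G'') : Prop :=
  [/\ is_morph i, is_morph p, forall x, lker (i x) = 0%VS,
      forall x, limg (p x) = fullv & forall x, limg (i x) = lker (p x)].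

Definition triv (V : vectType k) : prebundle :=
  @PreBundle (fun _ => V)
    (fun s x => forall xi : lin_dual V, regular_fun (fun y => xi (s y)) x).

Definition hom_vb (G H : prebundle) : prebundle :=
  @PreBundle (fun x => 'Hom(G x, H x))
    (fun p x => forall s : section G,
       regular_at s x -> @regular_at H (fun y => p y (s y)) x).

Definition dual_vb (G : prebundle) : prebundle := hom_vb G (triv k^o).

Definition tens_vb (G H : prebundle) : prebundle :=
  @PreBundle (fun x => tens (G x) (H x))
    (fun t x => exists (m : nat) (a : 'I_m -> section G) (b : 'I_m -> section H),
       (forall l, regular_at (a l) x /\ regular_at (b l) x) /\
       near x (fun y => t y = \sum_l tns (a l y) (b l y))).

Definition dsum_vb (G H : prebundle) : prebundle :=
  @PreBundle (fun x => (G x * H x)%type)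
    (fun s x => @regular_at G (fun y => (s y).1) x /\
                @regular_at H (fun y => (s y).2) x).

Definition ker_vb (G H : prebundle) (B : vb_map G H) : prebundle :=
  @PreBundle (fun x => subvs_of (lker (B x)))
    (fun s x => @regular_at G (fun y => vsval (s y)) x).

(* Ker B / Im A *)
Definition cohom_vb (G1 G H : prebundle) (A : vb_map G1 G) (B : vb_map G H) :
    prebundle :=
  @PreBundle (fun x => subquot (lker (B x)) (limg (A x)))
    (fun s x => exists2 v : section G, regular_at v x &
       near x (fun y => v y \in lker (B y) /\
                        s y = sq_class (lker (B y)) (limg (A y)) (v y))).

(* O(-1) is the tautological line bundle, a subbundle of the trivial bundle
   with fibre k^4. *)
Definition Om1 : prebundle :=
  @PreBundle (fun x => subvs_of (val x))
    (fun s x => forall j, regular_fun (fun y => (vsval (s y)) 0 j) x).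

Definition O1 : prebundle := dual_vb Om1.

Definition Om2 : prebundle := tens_vb Om1 Om1.

Definition is_monad (G1 G G2 : prebundle) (A : vb_map G1 G) (B : vb_map G G2) :
    Prop :=
  [/\ [/\ exists r, is_vbundle r G1, exists r, is_vbundle r G &
          exists r, is_vbundle r G2],
      is_morph A, is_morph B, forall x, (limg (A x) <= lker (B x))%VS &
      (forall x, lker (A x) = 0%VS) /\ (forall x, limg (B x) = fullv)].

(* Cech 1-cochains on an open cover indexed by an arbitrary type.  Elements
   of H^1(G) are represented by cocycles, equality in H^1(G) being the
   relation cohomologous. *)
Record cochain (G : prebundle) := Cochain {
  idx : Type;
  cov : idx -> P3 -> Prop;
  cval : idx -> idx -> section G
}.

Definition is_cover (I : Type) (c : I -> P3 -> Prop) : Prop :=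
  (forall i, zopen (c i)) /\ (forall x, exists i, c i x).

Definition is_cocycle (G : prebundle) (c : cochain G) : Prop :=
  [/\ is_cover (@cov G c),
      forall i j x, cov i x -> cov j x -> regular_at (@cval G c i j) x &
      forall i j l x, cov i x -> cov j x -> cov l x ->
        @cval G c i j x + cval j l x = cval i l x].

(* c - c' is a coboundary on some common refinement of the two covers. *)
Definition cohomologous (G : prebundle) (c c' : cochain G) : Prop :=
  exists (J : Type) (N : J -> P3 -> Prop)
         (a : J -> idx c) (b : J -> idx c') (h : J -> section G),
    [/\ is_cover N,
        forall j x, N j x -> cov (a j) x /\ cov (b j) x,
        forall j x, N j x -> regular_at (h j) x &
        forall j j' x, N j x -> N j' x ->
          cval (a j) (a j') x - cval (b j) (b j') x = h j' x - h j x].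

Definition zero_cochain (G : prebundle) : cochain G :=
  @Cochain G unit (fun _ _ => True) (fun _ _ _ => 0).

Definition H1_vanishes (G : prebundle) : Prop :=
  forall c : cochain G, is_cocycle c -> cohomologous c (zero_cochain G).

Definition push (G H : prebundle) (p : forall x, G x -> H x) (c : cochain G) :
    cochain H :=
  @Cochain H (idx c) (@cov G c) (fun i j x => p x (cval i j x)).

Definition sum_cochain (G : prebundle) m (c : 'I_m -> cochain G) : cochain G :=
  @Cochain G (forall l, idx (c l)) (fun i x => forall l, cov (i l) x)
    (fun i j x => \sum_l cval (i l) (j l) x).

(* For a short exact sequence 0 -> G' -a-> G -b-> G'' -> 0 and a global
   section t of G'', the cocycle c represents the image of t under the
   connecting homomorphism H^0(G'') -> H^1(G'). *)
Definition connecting (G' G G'' : prebundle)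
    (a : forall x, G' x -> G x) (b : forall x, G x -> G'' x)
    (t : section G'') (c : cochain G') : Prop :=
  is_cocycle c /\
  exists v : idx c -> section G,
    (forall i x, cov i x -> regular_at (v i) x /\ b x (v i x) = t x) /\
    (forall i j x, cov i x -> cov j x -> a x (cval i j x) = v j x - v i x).

(* The extension 0 -> K -i-> E -p-> F -> 0 has class [c] in
   Ext^1(F, K) = H^1(Hom(F, K)), that is, [c] is the image of id_F under the
   connecting homomorphism of 0 -> Hom(F,K) -> Hom(F,E) -> Hom(F,F) -> 0. *)
Definition ext_class (K E F : prebundle) (i : vb_map K E) (p : vb_map E F)
    (c : cochain (hom_vb F K)) : Prop :=
  exists2 c0 : cochain (hom_vb F K),
    @connecting (hom_vb F K) (hom_vb F E) (hom_vb F F)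
      (fun x g => (i x \o g)%VF) (fun x g => (p x \o g)%VF)
      (fun x => \1%VF) c0 &
    cohomologous c c0.

(* F (x) K -> Hom(F, K) given by the form q : F -> F^*. *)
Definition tens_to_hom (F K : prebundle) (q : vb_map F (dual_vb F)) (x : P3) :
    tens_vb F K x -> hom_vb F K x :=
  tlift (fun u y => linfun (fun u' : F x => (q x u u' : k) *: y)).

(* K(1) x O(-1) -> K *)
Definition contract (K : prebundle) (x : P3) (s : tens_vb K O1 x) (l : Om1 x) :
    K x :=
  tlift (fun y (lam : O1 x) => (lam l : k) *: y) s.

(* H^1(F(-1)) x H^0(K(1)) -> H^1(F (x) K) *)
Definition cup (F K : prebundle) (h : cochain (tens_vb F Om1))
    (s : section (tens_vb K O1)) : cochain (tens_vb F K) :=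
  push (G := tens_vb F Om1) (H := tens_vb F K)
    (fun x => tlift (fun u l => tns u (contract (s x) l))) h.

Definition trivial_on_line (r : nat) (F : prebundle) (L : {vspace 'rV[k]_4}) :
    Prop :=
  exists b : 'I_r -> section F, forall x : P3, (val x <= L)%VS ->
    basis_of {:F x} (frame b x) /\
    forall i, exists2 s : section F, regular_at s x &
      near x (fun y => (val y <= L)%VS -> s y = b i y).

(* q is the symplectic or orthogonal structure of F. *)
Definition is_instanton (r : nat) (ty : form_type) (F : prebundle)
    (q : vb_map F (dual_vb F)) : Prop :=
  [/\ is_vbundle r F,
      is_iso q /\ (forall x, form_symmetry ty (q x)),
      exists2 L : {vspace 'rV[k]_4}, \dim L = 2%N & trivial_on_line r F L &
      H1_vanishes (tens_vb F Om2)].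

Section Monad.
Variables W V : vectType k.

Definition WOm1 : prebundle := tens_vb (triv W) Om1.

Definition WdO1 : prebundle := tens_vb (triv (lin_dual W)) O1.

(* B is the dual of A, i.e. (B v)(w (x) l) = J(v, A(w (x) l)): the composite
   of v |-> J(v, _) : V -> V^* with the transpose of A. *)
Definition is_adjoint (J : 'Hom(V, lin_dual V))
    (A : vb_map WOm1 (triv V)) (B : vb_map (triv V) WdO1) : Prop :=
  forall x (v : V) (w : W) (l : Om1 x),
    tlift (fun (xi : lin_dual W) (lam : O1 x) => xi w * lam l : k^o) (B x v)
      = J v (A x (tns w l)).

Variables (A : vb_map WOm1 (triv V)) (B : vb_map (triv V) WdO1).
Variables (F : prebundle) (phi : vb_map (cohom_vb A B) F).

(* Ker B -> Ker B / Im A -> F *)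
Definition ker_proj (x : P3) : ker_vb B x -> F x :=
  fun v => phi x (sq_class (lker (B x)) (limg (A x)) (vsval v)).

(* F is the instanton bundle given by the monad (A, B): dim W = n,
   dim V = 2n + r, J is a nondegenerate form on V of the same type as q,
   B is the dual of A, and phi identifies Ker B / Im A with F, the form q
   being the one induced by J. *)
Definition instanton_monad (n r : nat) (ty : form_type)
    (q : vb_map F (dual_vb F)) (J : 'Hom(V, lin_dual V)) : Prop :=
  [/\ \dim {:W} = n /\ \dim {:V} = (2 * n + r)%N,
      lker J = 0%VS /\ form_symmetry ty J,
      is_monad A B /\ is_adjoint J A B,
      is_iso phi &
      forall x (u v : ker_vb B x),
        q x (ker_proj u) (ker_proj v) = J (vsval u) (vsval v)].

(* xi in W^* as a global section of W^* (x) O(1) (x) O(-1) = W^* (x) O. *)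
Definition dual_section (xi : lin_dual W) : section (tens_vb WdO1 Om1) :=
  fun x => \sum_j tns (tns xi (dbas j) : WdO1 x) (bas j : Om1 x).

(* h represents the image of xi under the identification
   W^* = H^0(W^* (x) O) -> H^1(Ker B (x) O(-1)) -> H^1(F(-1)). *)
Definition dual_to_H1 (xi : lin_dual W) (h : cochain (tens_vb F Om1)) : Prop :=
  is_cocycle h /\
  exists2 c : cochain (tens_vb (ker_vb B) Om1),
    @connecting (tens_vb (ker_vb B) Om1) (tens_vb (triv V) Om1)
      (tens_vb WdO1 Om1)
      (fun x => tmap (fun v => vsval v) id) (fun x => tmap (B x) id)
      (dual_section xi) c &
    cohomologous h
      (push (G := tens_vb (ker_vb B) Om1) (H := tens_vb F Om1)
         (fun x => tmap (@ker_proj x) id) c).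

Variables (K : prebundle) (f : vb_map WOm1 K).

(* The class of e is the image of f under the canonical homomorphism
   Hom(W (x) O(-1), K) = W^* (x) H^0(K(1)) = H^1(F(-1)) (x) H^0(K(1))
     -> H^1(F (x) K):
   f = sum_l xi_l (x) s_l, h_l is the class of xi_l in H^1(F(-1)), and
   e = sum_l h_l u s_l. *)
Definition canonical_image (e : cochain (tens_vb F K)) : Prop :=
  exists (m : nat) (xi : 'I_m -> lin_dual W)
         (s : 'I_m -> section (tens_vb K O1))
         (h : 'I_m -> cochain (tens_vb F Om1)),
    [/\ forall l, global_section (s l),
        forall x (w : W) (z : Om1 x),
          f x (tns w z) = \sum_l (xi l w : k) *: contract (s l x) z,
        forall l, dual_to_H1 (xi l) (h l) &
        cohomologous e (sum_cochain (fun l => cup (h l) (s l)))].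

Definition ext_A : vb_map WOm1 (dsum_vb (triv V) K) :=
  fun x => linfun (fun t : WOm1 x => (A x t, f x t) : dsum_vb (triv V) K x).

Definition ext_B : vb_map (dsum_vb (triv V) K) WdO1 :=
  fun x => linfun (fun p : dsum_vb (triv V) K x => B x p.1).

Definition ext_E : prebundle := cohom_vb ext_A ext_B.

(* y |-> [(0, y)] *)
Definition ext_i : vb_map K ext_E :=
  fun x => linfun (fun y : K x =>
    sq_class (lker (ext_B x)) (limg (ext_A x)) (0 : V, y)).

(* [(v, y)] |-> phi [v] *)
Definition ext_p : vb_map ext_E F :=
  fun x => linfun (fun t : ext_E x =>
    phi x (sq_class (lker (B x)) (limg (A x)) (vsval t).1)).

End Monad.

End ProjectiveSpace.

(* Main.v *)
Require Import Defs.
From HB Require Import structures.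
From mathcomp Require Import all_boot all_order all_algebra.
From mathcomp Require Import reals complex.
From mathcomp Require Import mpoly.

(* Lift the classes xi_l occurring in f = sum_l xi_l (x) s_l locally to
   sections a_{l,i} of V (x) O(-1).  The maps g_i : V -> K,
   g_i(v) = sum_l s_l . J(a_{l,i}, v), satisfy g_i A = f because B is the
   J-adjoint of A and B a_{l,i} = xi_l.  Hence [v] |-> [(v, g_i(v))] is a local
   splitting F -> E with retraction [(v, y)] |-> y - g_i(v), so that E is locally
   K (+) F, and two such splittings differ by g_j - g_i, that is by the pairing
   with a_{l,j} - a_{l,i}, which is the cocycle defining e. *)

Set Implicit Arguments.
Unset Strict Implicit.
Unset Printing Implicit Defensive.

Import GRing.Theory.

(** The class of E is by definition the image of [\1] under a connecting map, so any family of local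
    splittings computes it; the care goes into signs and representatives. The lift a stands in the
    first argument of J everywhere: in the adjunction that gives g_i A = f, and, through q, in the
    map from F (x) K to Hom(F, K). One formula thus serves both types of form, and no sign appears.
    The fibres of a quotient are complements, so a map out of E or F is evaluated on a
    representative that is not the one at hand. The equation g_i A = f is what makes the section and
    the retraction independent of that choice. The lifts of the various xi_l live on unrelated
    covers, so the g_i are indexed by tuples with one index from each cover. Moreover h_l is known
    only up to a coboundary: the splittings produce another cocycle in the class of e, and the two
    are compared by stability of [cohomologous] under push-forward, finite sums and composition.
    Local freeness of E is carried over from K (+) F along the local isomorphisms. *)

Section LinearAlgebra.
Local Open Scope ring_scope.
Variable k : fieldType.
Implicit Types S U V T : vectType k.

(** * Linear and bilinear maps, tensors *)

Lemma linfun_linE U V (g : U -> V) : linear g -> linfun g =1 g.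
Proof.
move=> lin; pose mix := GRing.isLinear.Build k U V _ _ lin.
pose G : {linear U -> V} := HB.pack g mix.
exact: (lfunE G).
Qed.

Section LinearFunction.
Variables (U V : vectType k) (g : U -> V).
Hypothesis lin : linear g.

(** Maps such as [tlift b], [tmap p q], [ker_proj] and [contract] are bare functions, so linearity
    travels as a hypothesis and the usual rules are recovered through [linfun]. *)
Lemma lin0 : g 0 = 0.
Proof. by rewrite -(linfun_linE lin) linear0. Qed.

Lemma linD u v : g (u + v) = g u + g v.
Proof. by rewrite -!(linfun_linE lin) linearD. Qed.

Lemma linB u v : g (u - v) = g u - g v.
Proof. by rewrite -!(linfun_linE lin) linearB. Qed.

Lemma linZ a u : g (a *: u) = a *: g u.
Proof. by rewrite -!(linfun_linE lin) linearZ. Qed.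

Lemma lin_sum I (s : seq I) (F : I -> U) :
  g (\sum_(i <- s) F i) = \sum_(i <- s) g (F i).
Proof.
rewrite -(linfun_linE lin) linear_sum; apply: eq_bigr => i _.
exact: linfun_linE.
Qed.

End LinearFunction.

Lemma lfun_linear U V (g : 'Hom(U, V)) : linear g.
Proof. by move=> a u v; rewrite linearP. Qed.

Lemma vsval_linear U (X : {vspace U}) : linear (@vsval k U X).
Proof. by move=> a u v; rewrite linearP. Qed.

Definition bilin U V T (b : U -> V -> T) : Prop :=
  (forall v, linear (b^~ v)) /\ (forall u, linear (b u)).

Lemma tlift_linear U V T (b : U -> V -> T) :
  (forall v, linear (b^~ v)) -> linear (tlift b).
Proof.
move=> bl a s t; rewrite /tlift scaler_sumr -big_split; apply: eq_bigr => j _ /=.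
by rewrite add_lfunE scale_lfunE bl.
Qed.

Lemma tliftE U V T (b : U -> V -> T) u v : bilin b -> tlift b (tns u v) = b u v.
Proof. by case=> bl br; apply: tlift_tns. Qed.

Lemma tns_bilin U V : bilin (@tns k U V).
Proof.
split=> [v a u u' | u a v v']; apply/lfunP => eta.
  by rewrite add_lfunE scale_lfunE !tnsE scalerDr !scalerA mulrC.
by rewrite add_lfunE scale_lfunE !tnsE linearP scalerDl scalerA.
Qed.

Lemma bilin_comp U V T U' V' (b : U' -> V' -> T) (p : U -> U') (q : V -> V') :
  bilin b -> linear p -> linear q -> bilin (fun u v => b (p u) (q v)).
Proof.
move=> [bl br] lp lq.
by split=> [v a u u' | u a v v'] /=; rewrite ?lp ?lq ?bl ?br.
Qed.

Lemma tmap_linear U V U' V' (p : U -> U') (q : V -> V') :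
  linear p -> linear (tmap p q).
Proof.
move=> lp; apply: tlift_linear => v a u u'.
by rewrite lp (tns_bilin _ _).1.
Qed.

Lemma tmap_tns U V U' V' (p : U -> U') (q : V -> V') u v :
  linear p -> linear q -> tmap p q (tns u v) = tns (p u) (q v).
Proof. by move=> lp lq; rewrite /tmap tliftE //; apply: bilin_comp (tns_bilin _ _) _ _. Qed.

Lemma tens_ext U V T (g h : tens U V -> T) :
  linear g -> linear h -> (forall u v, g (tns u v) = h (tns u v)) -> g =1 h.
Proof.
move=> lg lh gh t; rewrite (tens_expand t) !lin_sum //.
by apply: eq_bigr => j _.
Qed.

Lemma comp_linear U V T (g : V -> T) (h : U -> V) :
  linear g -> linear h -> linear (fun u => g (h u)).
Proof. by move=> lg lh a u v; rewrite lh lg. Qed.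

Lemma sum_linear U V m (g : 'I_m -> U -> V) :
  (forall l, linear (g l)) -> linear (fun u => \sum_l g l u).
Proof.
move=> lg a u v; rewrite scaler_sumr -big_split.
by apply: eq_bigr => l _; rewrite lg.
Qed.

Lemma pair_linE U V (a : k) (u u' : U) (v v' : V) :
  a *: (u, v) + (u', v') = (a *: u + u', a *: v + v') :> (U * V)%type.
Proof. by []. Qed.

Lemma graph_linear S U V T (e : 'Hom((U * V)%type, T)) (h : S -> U) (g : 'Hom(U, V)) :
  linear h -> linear (fun s => e (h s, g (h s))).
Proof. by move=> lh a u v; rewrite lh linearP -pair_linE linearP. Qed.

Lemma retract_linear S U V (h : S -> (U * V)%type) (g : 'Hom(U, V)) :
  linear h -> linear (fun s => (h s).2 - g (h s).1).
Proof.
by move=> lh a u v; rewrite lh !linearP /= scalerBr scalerN addrACA.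
Qed.

Lemma pair_linear S U V (h : 'Hom(S, U)) (g : 'Hom(S, V)) :
  linear (fun s => (h s, g s)).
Proof. by move=> a u v; rewrite !linearP. Qed.

(** * Subquotients, kernels and images *)

Section Subquotient.
Variables (T : vectType k) (U W : {vspace T}).
Hypothesis WU : (W <= U)%VS.

Lemma sq_class_sub u v :
  u \in U -> v \in U -> (sq_class U W u == sq_class U W v) = (u - v \in W).
Proof. by move=> Uu Uv; rewrite -subr_eq0 -linearB; apply: sq_class_eq0; rewrite ?rpredB. Qed.

Lemma sq_vsval_mem (t : subquot U W) : vsval t \in U.
Proof. by apply: (subvP (diffvSl U W)); apply: subvsP. Qed.

Lemma sq_vsvalK (t : subquot U W) : sq_class U W (vsval t) = t.
Proof.
by rewrite /sq_class !lfunE /= lfunE /= daddv_pi_id ?subvsP ?vsvalK ?capv_diff.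
Qed.

(** The representative stored in a class lies in the canonical complement and in general differs
    from [u]; this is all that is ever known about it. *)
Lemma sq_class_repr u : u \in U -> vsval (sq_class U W u) - u \in W.
Proof. by move=> Uu; rewrite -sq_class_sub ?sq_vsvalK ?sq_vsval_mem. Qed.

End Subquotient.

Lemma lker_eq0P U V (g : 'Hom(U, V)) :
  (forall u, g u = 0 -> u = 0) <-> lker g = 0%VS.
Proof.
split=> [inj | g0 u gu].
  by apply/eqP; rewrite -subv0; apply/subvP => u; rewrite memv_ker memv0 => /eqP/inj->.
by apply/eqP; rewrite -memv0 -g0 memv_ker gu.
Qed.

Lemma limg_fullP U V (g : 'Hom(U, V)) :
  (forall v, exists u, g u = v) <-> limg g = fullv.
Proof.
split=> [surj | gT v].
  apply/eqP; rewrite eqEsubv subvf; apply/subvP => v _.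
  by have [u <-] := surj v; rewrite memv_img ?memvf.
by have /memv_imgP[u _ ->] : v \in limg g by [rewrite gT memvf]; exists u.
Qed.

Lemma splitting_iso S T U (i : 'Hom(S, T)) (p : 'Hom(T, U)) (j : 'Hom(U, T))
    (r : 'Hom(T, S)) :
  (forall y, r (i y) = y) -> (forall u, p (j u) = u) -> (forall y, p (i y) = 0) ->
  (forall t, t = i (r t) + j (p t)) ->
  let h := linfun (fun t => (r t, p t)) in lker h = 0%VS /\ limg h = fullv.
Proof.
move=> ri pj pi0 dec h; have hE t : h t = (r t, p t) := linfun_linE (pair_linear r p) t.
split.
  by apply/lker_eq0P => t; rewrite hE => -[r0 p0]; rewrite (dec t) r0 p0 !linear0 addr0.
apply/limg_fullP => -[y u]; exists (i y + j u).
rewrite hE !linearD /= ri pi0 pj add0r; congr (_, _).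
(* Decomposing [j u] itself gives [i (r (j u)) = 0], and [r] is a left inverse of [i]. *)
suff -> : r (j u) = 0 by rewrite addr0.
rewrite -[LHS]ri; suff -> : i (r (j u)) = 0 by rewrite linear0.
by apply: (addIr (j u)); rewrite add0r [RHS](dec (j u)) pj.
Qed.

End LinearAlgebra.

(** * Zariski opens, regular functions and regular sections *)

Section RegularSections.
Local Open Scope ring_scope.
Variable k : closedFieldType.
Implicit Types (x y : P3 k) (P Q N : P3 k -> Prop) (G H L : prebundle k).

Lemma zopenT : zopen (fun _ : P3 k => True).
Proof.
exists (fun p => p = 1); split=> [p ->|x]; first by exists 0%N; apply: dhomog1.
by split=> // _; exists 1 => // v _ _; rewrite /ev meval1 oner_neq0.
Qed.

Lemma zopenI P Q : zopen P -> zopen Q -> zopen (fun x => P x /\ Q x).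
Proof.
move=> [S [hS SP]] [S' [hS' SQ]].
(* A product of forms is nonzero at a point exactly when both factors are, so the products define
   the intersection. *)
exists (fun p => exists a b, [/\ S a, S' b & p = a * b]); split.
  move=> p [a [b [/hS[d hd] /hS'[d' hd'] ->]]].
  by exists (d + d')%N; apply: dhomogM.
move=> x; rewrite SP SQ; split=> [[[a Sa a0] [b Sb b0]]|].
  exists (a * b); first by exists a, b.
  by move=> v xv v0; rewrite /ev mevalM mulf_neq0 ?a0 ?b0.
move=> [p [a [b [Sa Sb ->]]] ab0]; split.
  exists a => // v xv v0; have := ab0 v xv v0.
  by rewrite /ev mevalM mulf_eq0 negb_or => /andP[].
exists b => // v xv v0; have := ab0 v xv v0.
by rewrite /ev mevalM mulf_eq0 negb_or => /andP[].
Qed.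

Lemma eq_zopen P Q : (forall x, P x <-> Q x) -> zopen P -> zopen Q.
Proof. by move=> PQ [S [hS SP]]; exists S; split=> // x; rewrite -PQ. Qed.

Lemma zopen_forall m (P : 'I_m -> P3 k -> Prop) :
  (forall l, zopen (P l)) -> zopen (fun x => forall l, P l x).
Proof.
elim: m P => [|m IHm] P oP; first by apply: eq_zopen zopenT => x; split=> // _ [].
apply: eq_zopen (zopenI (oP ord0) (IHm _ (fun l => oP (lift ord0 l)))) => x.
split=> [[P0 PS] l|Px]; last by split.
by case: (unliftP ord0 l) => [j|] ->.
Qed.

Lemma near_at x P : near x P -> P x.
Proof. by case=> N [_ Nx]; apply. Qed.

Lemma near_open N x P : zopen N -> N x -> (forall y, N y -> P y) -> near x P.
Proof. by move=> oN Nx NP; exists N. Qed.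

Lemma nearW x P Q : (forall y, P y -> Q y) -> near x P -> near x Q.
Proof. by move=> PQ [N [oN Nx NP]]; exists N; split=> // y /NP/PQ. Qed.

Lemma near_all x P : (forall y, P y) -> near x P.
Proof. by move=> Py; exists (fun _ => True); split=> //; apply: zopenT. Qed.

Lemma nearI x P Q : near x P -> near x Q -> near x (fun y => P y /\ Q y).
Proof.
move=> [N [oN Nx NP]] [N' [oN' Nx' NQ]].
exists (fun y => N y /\ N' y); split=> [| |y [/NP ? /NQ ?]] //; exact: zopenI.
Qed.

Lemma nearS x P Q R :
  near x P -> near x Q -> (forall y, P y -> Q y -> R y) -> near x R.
Proof. by move=> nP nQ PQR; apply: nearW (nearI nP nQ) => y []; apply: PQR. Qed.

Lemma near_near x P : near x P -> near x (fun y => near y P).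
Proof. by move=> [N [oN Nx NP]]; exists N; split=> // y Ny; exists N. Qed.

Lemma eq_regular_fun x (f g : P3 k -> k) :
  near x (fun y => f y = g y) -> regular_fun f x -> regular_fun g x.
Proof.
move=> fg [d [p [q [hp hq pq]]]]; exists d, p, q; split=> //.
by apply: (nearS fg pq) => y <- pqy.
Qed.

Lemma regular_cst x (a : k) : regular_fun (fun _ => a) x.
Proof.
exists 0%N, (a *: 1), 1; split; [apply/dhomogZ/dhomog1 | exact: dhomog1|].
apply: near_all => y v _ _; rewrite /ev mevalZ meval1 mulr1 divr1.
by rewrite oner_neq0.
Qed.

Lemma regularD x (f g : P3 k -> k) :
  regular_fun f x -> regular_fun g x -> regular_fun (fun y => f y + g y) x.
Proof.
move=> [d [p [q [hp hq pq]]]] [d' [p' [q' [hp' hq' pq']]]].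
exists (d + d')%N, (p * q' + p' * q), (q * q'); split.
- by rewrite rpredD //; [|rewrite addnC]; apply: dhomogM.
- exact: dhomogM.
apply: (nearS pq pq') => y pqy pqy' v yv v0.
have [q0 ->] := pqy v yv v0; have [q0' ->] := pqy' v yv v0.
by rewrite /ev mevalD !mevalM mulf_neq0 // addf_div.
Qed.

Lemma regularM x (f g : P3 k -> k) :
  regular_fun f x -> regular_fun g x -> regular_fun (fun y => f y * g y) x.
Proof.
move=> [d [p [q [hp hq pq]]]] [d' [p' [q' [hp' hq' pq']]]].
exists (d + d')%N, (p * p'), (q * q'); split; try exact: dhomogM.
apply: (nearS pq pq') => y pqy pqy' v yv v0.
have [q0 ->] := pqy v yv v0; have [q0' ->] := pqy' v yv v0.
by rewrite /ev !mevalM mulf_neq0 // mulf_div.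
Qed.

Lemma regular_sum x I (s : seq I) (f : I -> P3 k -> k) :
  (forall i, regular_fun (f i) x) ->
  regular_fun (fun y => \sum_(i <- s) f i y) x.
Proof.
move=> rf; elim: s => [|i s IHs].
  by apply: eq_regular_fun (regular_cst x 0); apply: near_all => y; rewrite big_nil.
apply: eq_regular_fun (regularD (rf i) IHs).
by apply: near_all => y; rewrite big_cons.
Qed.

(* What is used of sheaves of modules: it also holds for the tensor, Hom and
   cohomology prebundles, whose local freeness is never needed. *)
Record sheafy G : Prop := Sheafy {
  reg_near : forall x (s t : section G),
    near x (fun y => s y = t y) -> regular_at s x -> regular_at t x;
  reg0 : forall x, @regular_at k G (fun _ => 0) x;
  regD : forall x (s t : section G),
    regular_at s x -> regular_at t x -> @regular_at k G (fun y => s y + t y) x;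
  regZ : forall x (a : P3 k -> k) (s : section G),
    regular_fun a x -> regular_at s x -> @regular_at k G (fun y => a y *: s y) x
}.

Section SheafyTheory.
Variable G : prebundle k.
Hypothesis shG : sheafy G.

Lemma eq_reg x (s t : section G) :
  (forall y, s y = t y) -> regular_at s x -> regular_at t x.
Proof. by move=> st; apply: reg_near => //; apply: near_all. Qed.

Lemma regN x (s : section G) :
  regular_at s x -> @regular_at k G (fun y => - s y) x.
Proof.
move=> rs; apply: eq_reg (regZ shG (regular_cst x (-1)) rs) => y.
by rewrite scaleN1r.
Qed.

Lemma regB x (s t : section G) :
  regular_at s x -> regular_at t x -> @regular_at k G (fun y => s y - t y) x.
Proof. by move=> rs rt; apply: regD => //; apply: regN. Qed.

Lemma reg_sum x I (r : seq I) (s : I -> section G) :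
  (forall i, regular_at (s i) x) ->
  @regular_at k G (fun y => \sum_(i <- r) s i y) x.
Proof.
move=> rs; elim: r => [|i r IHr].
  by apply: eq_reg (reg0 shG x) => y; rewrite big_nil.
by apply: eq_reg (regD shG (rs i) IHr) => y; rewrite big_cons.
Qed.

End SheafyTheory.

Lemma vbundle_sheafy r G : is_vbundle r G -> sheafy G.
Proof.
(* Every axiom concerns a single point [x], so the frame near [x] is used at [x] alone, where it
   turns regularity into regularity of coordinates. *)
move=> vbG; have regE x : exists b : 'I_r -> section G, forall s : section G,
    regular_at s x <-> forall i, regular_fun (fun z => coord (frame b z) i (s z)) x.
  by have [b /near_at[_ bE]] := vbG x; exists b.
split=> [x s t st|x|x s t|x a s ra]; have [b bE] := regE x; rewrite !bE.
- move=> rs i; apply: eq_regular_fun (rs i).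
  by apply: (nearW _ st) => y ->.
- move=> i; apply: eq_regular_fun (regular_cst x 0).
  by apply: near_all => y; rewrite linear0.
- move=> rs rt i; apply: eq_regular_fun (regularD (rs i) (rt i)).
  by apply: near_all => y; rewrite linearD.
- move=> rs i; apply: eq_regular_fun (regularM ra (rs i)).
  by apply: near_all => y; rewrite linearZ.
Qed.

Lemma triv_sheafy (V : vectType k) : sheafy (triv V).
Proof.
split=> [x s t st rs xi|x xi|x s t rs rt xi|x a s ra rs xi].
- apply: eq_regular_fun (rs xi).
  by apply: (nearW _ st) => y ->.
- apply: eq_regular_fun (regular_cst x 0).
  by apply: near_all => y; rewrite linear0.
- apply: eq_regular_fun (regularD (rs xi) (rt xi)).
  by apply: near_all => y; rewrite linearD.
- apply: eq_regular_fun (regularM ra (rs xi)).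
  by apply: near_all => y; rewrite linearZ.
Qed.

Lemma hom_sheafy G H : sheafy H -> sheafy (hom_vb G H).
Proof.
move=> shH; split=> [x s t st rs u ru|x u ru|x s t rs rt u ru|x a s ra rs u ru].
- by apply: (reg_near shH _ (rs u ru)); apply: (nearW _ st) => y ->.
- by apply: (eq_reg shH _ (reg0 shH x)) => y; rewrite zero_lfunE.
- by apply: (eq_reg shH _ (regD shH (rs u ru) (rt u ru))) => y; rewrite add_lfunE.
- by apply: (eq_reg shH _ (regZ shH ra (rs u ru))) => y; rewrite scale_lfunE.
Qed.

Lemma tens_sheafy G H : sheafy G -> sheafy (tens_vb G H).
Proof.
move=> shG; split=> [x s t st|x|x s t|x a s ra].
- move=> [m [u [v [ruv suv]]]]; exists m, u, v; split=> //.
  by apply: (nearS st suv) => y <-.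
- exists 0%N, (fun _ _ => 0), (fun _ _ => 0); split=> [[]//|].
  by apply: near_all => y; rewrite big_ord0.
- move=> [m [u [v [ruv suv]]]] [m' [u' [v' [ruv' suv']]]].
  exists (m + m')%N,
    (fun l => match split l with inl i => u i | inr i => u' i end),
    (fun l => match split l with inl i => v i | inr i => v' i end); split.
    by move=> l; case: split.
  apply: (nearS suv suv') => y -> ->; rewrite big_split_ord /=.
  by congr (_ + _); apply: eq_bigr => i _; rewrite ?(unsplitK (inl _)) ?(unsplitK (inr _)).
- move=> [m [u [v [ruv suv]]]]; exists m, (fun l y => a y *: u l y), v; split.
    by move=> l; have [ru rv] := ruv l; split=> //; apply: regZ.
  apply: (nearW _ suv) => y ->; rewrite scaler_sumr; apply: eq_bigr => l _.
  by rewrite (linZ ((tns_bilin _ _).1 _)).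
Qed.

Lemma dsum_sheafy G H : sheafy G -> sheafy H -> sheafy (dsum_vb G H).
Proof.
move=> shG shH; split=> [x s t st [r1 r2]|x|x s t [r1 r2] [r1' r2']|x a s ra [r1 r2]].
- by split; [apply: reg_near shG _ _ _ _ r1|apply: reg_near shH _ _ _ _ r2];
    apply: (nearW _ st) => y ->.
- by split; apply: reg0.
- by split; apply: (@regD _ _ x (fun y => _) (fun y => _)).
- by split; apply: (@regZ _ _ x a (fun y => _)).
Qed.

Lemma cohom_sheafy G1 G G2 (A : vb_map G1 G) (B : vb_map G G2) :
  sheafy G -> sheafy (cohom_vb A B).
Proof.
move=> shG; split=> [x s t st|x|x s t|x a s ra].
- move=> [v rv sv]; exists v => //.
  by apply: (nearS st sv) => y <-.
- exists (fun _ => 0); first exact: reg0.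
  by apply: near_all => y; rewrite mem0v linear0.
- move=> [v rv sv] [w rw tw]; exists (fun y => v y + w y); first exact: regD.
  apply: (nearS sv tw) => y [Bv ->] [Bw ->].
  by rewrite memvD // linearD.
- move=> [v rv sv]; exists (fun y => a y *: v y); first exact: regZ.
  by apply: (nearW _ sv) => y [Bv ->]; rewrite memvZ // linearZ.
Qed.

(** Near [x] a regular section of the tensor product is a finite sum of pure tensors of regular
    sections, so a bilinear operation need only be tested on pairs of regular sections. *)
Lemma tlift_regular G H L (b : forall y, G y -> H y -> L y)
    (t : section (tens_vb G H)) x :
  sheafy L -> (forall y, bilin (b y)) ->
  (forall (u : section G) (v : section H), regular_at u x -> regular_at v x ->
     @regular_at k L (fun y => b y (u y) (v y)) x) ->
  regular_at t x -> @regular_at k L (fun y => tlift (b y) (t y)) x.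
Proof.
move=> shL bb rb [m [u [v [ruv tuv]]]].
apply: (reg_near shL (s := fun y => \sum_l b y (u l y) (v l y))).
  apply: (nearW _ tuv) => y ->; rewrite (lin_sum (tlift_linear (bb y).1)).
  by apply: eq_bigr => l _; rewrite tliftE.
by apply: reg_sum => // l; have [ru rv] := ruv l; apply: rb.
Qed.

Lemma tns_regular G H (u : section G) (v : section H) x :
  regular_at u x -> regular_at v x ->
  @regular_at k (tens_vb G H) (fun y => tns (u y) (v y)) x.
Proof.
move=> ru rv; exists 1%N, (fun _ => u), (fun _ => v); split=> //.
by apply: near_all => y; rewrite big_ord1.
Qed.

End RegularSections.

(** * Frames of direct sums and transport of local freeness *)

Section LocallyFree.
Local Open Scope ring_scope.
Variable k : closedFieldType.
Implicit Types (x y : P3 k) (G H : prebundle k).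

(** A candidate for the dual basis proves freeness and spanning at once and also identifies
    [coord X], the function in which regularity is expressed. *)
Lemma dual_basis (V : vectType k) r (X : r.-tuple V) (c : 'I_r -> V -> k) :
  (forall i, linear (c i : V -> k^o)) ->
  (forall v, v = \sum_i c i v *: tnth X i) ->
  (forall i j, c i (tnth X j) = (i == j)%:R) ->
  basis_of fullv X /\ forall i v, coord X i v = c i v.
Proof.
move=> lc cX cD; have nX (i : 'I_r) : X`_i = tnth X i by rewrite (tnth_nth 0).
have c_sum (a : 'I_r -> k) i : c i (\sum_j a j *: X`_j) = a i.
  rewrite (lin_sum (lc i)) (bigD1 i) //= (linZ (lc i)) nX cD eqxx.
  rewrite big1 ?addr0 => [|j /negPf ji]; first exact: mulr1.
  by rewrite (linZ (lc i)) nX cD eq_sym ji scaler0.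
have fX : free X.
  by apply/freeP => a a0 i; rewrite -(c_sum a i) a0 (lin0 (lc i)).
have cXn v : v = \sum_i c i v *: X`_i.
  by rewrite {1}(cX v); apply: eq_bigr => i _; rewrite nX.
split=> [|i v]; last by rewrite {1}(cXn v) coord_sum_free.
apply/andP; split=> //; rewrite eqEsubv subvf; apply/subvP => v _.
rewrite (cXn v); apply: memv_suml => i _; apply: memvZ.
by apply/memv_span/mem_nth; rewrite size_tuple.
Qed.

Lemma basis_expand (V : vectType k) r (X : r.-tuple V) v :
  basis_of fullv X -> v = \sum_i coord X i v *: tnth X i.
Proof.
move=> bX; rewrite {1}(coord_basis bX (memvf v)).
by apply: eq_bigr => i _; rewrite (tnth_nth 0).
Qed.

Lemma basis_coord (V : vectType k) r (X : r.-tuple V) i j :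
  basis_of fullv X -> coord X i (tnth X j) = (i == j)%:R.
Proof.
by move=> bX; rewrite (tnth_nth 0) coord_free ?(basis_free bX) // eq_sym.
Qed.

Lemma tnth_frame G r (b : 'I_r -> section G) x i : tnth (frame b x) i = b i x.
Proof. by rewrite /frame tnth_mktuple. Qed.

Lemma dsum_vbundle r1 r2 G H :
  is_vbundle r1 G -> is_vbundle r2 H -> is_vbundle (r1 + r2) (dsum_vb G H).
Proof.
move=> vbG vbH x; have [b1 n1] := vbG x; have [b2 n2] := vbH x.
pose b (i : 'I_(r1 + r2)) : section (dsum_vb G H) :=
  match split i with inl j => fun y => (b1 j y, 0) | inr j => fun y => (0, b2 j y) end.
have bl j y : b (lshift r2 j) y = (b1 j y, 0).
  by rewrite /b (unsplitK (inl _ j)).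
have br j y : b (rshift r1 j) y = (0, b2 j y).
  by rewrite /b (unsplitK (inr _ j)).
pose c y (i : 'I_(r1 + r2)) (v : dsum_vb G H y) :=
  match split i with inl j => coord (frame b1 y) j v.1
                   | inr j => coord (frame b2 y) j v.2 end.
have cl j y v : c y (lshift r2 j) v = coord (frame b1 y) j v.1.
  by rewrite /c (unsplitK (inl _ j)).
have cr j y v : c y (rshift r1 j) v = coord (frame b2 y) j v.2.
  by rewrite /c (unsplitK (inr _ j)).
have bas y : basis_of {:G y} (frame b1 y) -> basis_of {:H y} (frame b2 y) ->
    basis_of {:dsum_vb G H y} (frame b y) /\
    forall i v, coord (frame b y) i v = c y i v.
  move=> B1 B2; apply: dual_basis => [i a u v|v|i j].
  - by rewrite /c; case: split => j; rewrite linearP.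
  - rewrite (eq_bigr (fun i => c y i v *: b i y)) => [|i _]; last by rewrite tnth_frame.
    rewrite big_split_ord /=; under eq_bigr => i _ do rewrite cl bl.
    under [X in _ + X]eq_bigr => i _ do rewrite cr br.
    rewrite [v in LHS]surjective_pairing.
    rewrite {1}(basis_expand v.1 B1) {1}(basis_expand v.2 B2).
    have pD (u1 v1 : G y) (u2 v2 : H y) : (u1, u2) + (v1, v2) = (u1 + v1, u2 + v2) by [].
    have pZ a (u1 : G y) (u2 : H y) : a *: (u1, u2) = (a *: u1, a *: u2) by [].
    have pl m (a : 'I_m -> k) (u : 'I_m -> G y) :
        \sum_i a i *: (u i, 0 : H y) = (\sum_i a i *: u i, 0).
      by apply: (big_ind2 (fun s t => s = (t, 0))) => // [s t s' t' -> ->|i _];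
        rewrite ?pZ ?scaler0 // pD addr0.
    have pr m (a : 'I_m -> k) (u : 'I_m -> H y) :
        \sum_i a i *: (0 : G y, u i) = (0, \sum_i a i *: u i).
      by apply: (big_ind2 (fun s t => s = (0, t))) => // [s t s' t' -> ->|i _];
        rewrite ?pZ ?scaler0 // pD addr0.
    rewrite pl pr pD addr0 add0r.
    by congr (_, _); apply: eq_bigr => i _; rewrite tnth_frame.
  - rewrite tnth_frame.
    case: (split_ordP i) => i' ->; case: (split_ordP j) => j' ->;
      rewrite ?cl ?cr ?bl ?br ?linear0 ?eq_shift //=.
    + by rewrite -(tnth_frame b1) basis_coord.
    + by rewrite -(tnth_frame b2) basis_coord.
(* Comparing regularity at [y] requires the coordinate functions to agree on a neighbourhood of [y],
   not just at [y]; hence the passage through [near_near]. *)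
exists b; have := nearI (near_near n1) (near_near n2).
apply: nearW => y [m1 m2].
have [B1 R1] := near_at m1; have [B2 R2] := near_at m2.
have cE : near y (fun z => forall i v, coord (frame b z) i v = c z i v).
  by apply: (nearS m1 m2) => z [C1 _] [C2 _]; have [] := bas z C1 C2.
split=> [|s]; first by have [] := bas y B1 B2.
rewrite /= R1 R2; split=> [[S1 S2] i|S].
  case: (split_ordP i) => j ->.
    by apply: eq_regular_fun (S1 j); apply: (nearW _ cE) => z ->; rewrite cl.
  by apply: eq_regular_fun (S2 j); apply: (nearW _ cE) => z ->; rewrite cr.
split=> j.
  by apply: eq_regular_fun (S (lshift r2 j)); apply: (nearW _ cE) => z ->; rewrite cl.
by apply: eq_regular_fun (S (rshift r1 j)); apply: (nearW _ cE) => z ->; rewrite cr.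
Qed.

(** The frame of [H] is pulled back by the inverse of [t]. Since [t] is an isomorphism only near
    [x], regularity is transported by an equivalence at each nearby point instead of by [is_iso]. *)
Lemma locally_iso_vbundle r G H :
  is_vbundle r H ->
  (forall x, exists t : vb_map G H, near x (fun y =>
     [/\ lker (t y) = 0%VS, limg (t y) = fullv &
         forall s : section G,
           regular_at s y <-> @regular_at k H (fun z => t z (s z)) y])) ->
  is_vbundle r G.
Proof.
move=> vbH iso x; have [b nb] := vbH x; have [t nt] := iso x.
pose b' (i : 'I_r) : section G := fun y => (t y)^-1%VF (b i y).
have bas y : basis_of {:H y} (frame b y) -> lker (t y) = 0%VS -> limg (t y) = fullv ->
    basis_of {:G y} (frame b' y) /\
    forall i v, coord (frame b' y) i v = coord (frame b y) i (t y v).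
  move=> B t0 tT; have tK v : (t y)^-1%VF (t y v) = v.
    by apply: lker0_lfunK; rewrite t0.
  have tVK v : t y ((t y)^-1%VF v) = v by apply: limg_lfunVK; rewrite tT memvf.
  apply: dual_basis => [i a u v|v|i j].
  - by rewrite !linearP.
  - rewrite -[v in LHS]tK (basis_expand (t y v) B) linear_sum.
    by apply: eq_bigr => i _; rewrite linearZ !tnth_frame -(basis_expand _ B).
  - by rewrite tnth_frame tVK -(tnth_frame b) basis_coord.
exists b'; have := nearI (near_near nb) (near_near nt).
apply: nearW => y [mb mt].
have [B R] := near_at mb; have [t0 tT tR] := near_at mt.
split=> [|s]; first by have [] := bas y B t0 tT.
rewrite tR R; split=> S i; apply: eq_regular_fun (S i);
  by apply: (nearS mb mt) => z [B' _] [t0' tT' _]; have [_ ->] := bas z B' t0' tT'.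
Qed.

End LocallyFree.

(** * Cech cocycles: push-forward, finite sums, change of representative *)

Section Cech.
Local Open Scope ring_scope.
Variable k : closedFieldType.
Implicit Types (x y : P3 k) (G H : prebundle k).

Definition reg_map G H (p : forall x, G x -> H x) : Prop :=
  (forall x, linear (p x)) /\
  (forall (s : section G) x,
     regular_at s x -> @regular_at k H (fun y => p y (s y)) x).

Lemma push_cocycle G H (p : forall x, G x -> H x) (c : cochain G) :
  reg_map p -> is_cocycle c -> is_cocycle (push p c).
Proof.
move=> [lp rp] [cov_c reg_c coc_c]; split=> // [i j x ci cj|i j l x ci cj cl] /=.
  by apply: rp; apply: reg_c.
by rewrite -(linD (lp x)) coc_c.
Qed.

Lemma push_cohomologous G H (p : forall x, G x -> H x) (c c' : cochain G) :
  reg_map p -> cohomologous c c' -> cohomologous (push p c) (push p c').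
Proof.
move=> [lp rp] [J [N [a [b [h [cN sub rh hE]]]]]].
exists J, N, a, b, (fun j y => p y (h j y)); split=> // [j x Nj|j j' x Nj Nj'] /=.
  by apply: rp; apply: rh.
by rewrite -!(linB (lp x)) hE.
Qed.

(** Finiteness of [m] enters twice: the intersections stay open, and the tuple of indices at a point
    comes from finite choice. *)
Lemma sum_cover m (I : 'I_m -> Type) (N : forall l, I l -> P3 k -> Prop) :
  (forall l, is_cover (N l)) ->
  is_cover (fun (i : forall l, I l) x => forall l, N l (i l) x).
Proof.
move=> cN; split=> [i|x]; first by apply: zopen_forall => l; have [oN _] := cN l.
by apply: (fin_all_exists (P := fun l j => N l j x)) => l; have [_ aN] := cN l.
Qed.

Lemma sum_cocycle G m (c : 'I_m -> cochain G) :
  sheafy G -> (forall l, is_cocycle (c l)) -> is_cocycle (sum_cochain c).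
Proof.
move=> shG coc; split=> [|i j x ci cj|i j l x ci cj cl] /=.
- by apply: (sum_cover (N := fun l => @cov k G (c l))) => l; have [] := coc l.
- by apply: reg_sum => // l; have [_ rc _] := coc l; apply: rc.
- by rewrite -big_split; apply: eq_bigr => t _ /=; have [_ _ ->] := coc t.
Qed.

Lemma sum_cohomologous G m (c c' : 'I_m -> cochain G) :
  sheafy G -> (forall l, cohomologous (c l) (c' l)) ->
  cohomologous (sum_cochain c) (sum_cochain c').
Proof.
move=> shG cc'; have {cc'}[J cc'] := fin_all_exists cc'.
have {cc'}[N cc'] := fin_all_exists cc'.
have {cc'}[a cc'] := fin_all_exists cc'.
have {cc'}[b cc'] := fin_all_exists cc'.
have {cc'}[h cc'] := fin_all_exists cc'.
exists (forall l, J l), (fun j x => forall l, N l (j l) x), (fun j l => a l (j l)),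
  (fun j l => b l (j l)), (fun j x => \sum_l h l (j l) x).
split=> [|j x Nj|j x Nj|j j' x Nj Nj'] /=.
- by apply: (sum_cover (N := N)) => l; have [] := cc' l.
- by split=> l; have [_ sub _ _] := cc' l; have [] := sub _ _ (Nj l).
- by apply: reg_sum => // l; have [_ _ rh _] := cc' l; apply: rh.
- by rewrite -!sumrB; apply: eq_bigr => l _; have [_ _ _ ->] := cc' l.
Qed.

(** The two relations may refine the cover of [c2] by different index maps [b] and [b']. The value
    of [c2] between [b] and [b'] corrects [h + h'], and the cocycle rule makes the corrections
    cancel. *)
Lemma cohomologous_trans G (c1 c2 c3 : cochain G) :
  sheafy G -> is_cocycle c2 ->
  cohomologous c1 c2 -> cohomologous c2 c3 -> cohomologous c1 c3.
Proof.
move=> shG [_ reg2 coc2] [J [N [a [b [h [cN sub rh hE]]]]]].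
move=> [J' [N' [b' [d [h' [cN' sub' rh' hE']]]]]].
exists (J * J')%type, (fun j x => N j.1 x /\ N' j.2 x), (fun j => a j.1),
  (fun j => d j.2), (fun j x => h j.1 x + h' j.2 x - cval (b j.1) (b' j.2) x).
split=> [|j x [Nj Nj']|j x [Nj Nj']|i j x [Ni Ni'] [Nj Nj']].
- split=> [j|x]; first by apply: zopenI; [apply: cN.1 | apply: cN'.1].
  by have [j Nj] := cN.2 x; have [j' Nj'] := cN'.2 x; exists (j, j').
- by split; [have [] := sub _ _ Nj | have [] := sub' _ _ Nj'].
- apply: (regB shG (s := fun y => _ + _)).
    by apply: regD => //; [apply: rh | apply: rh'].
  by apply: reg2; [have [] := sub _ _ Nj | have [] := sub' _ _ Nj'].
- have [_ ci] := sub _ _ Ni; have [_ cj] := sub _ _ Nj.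
  have [ci' _] := sub' _ _ Ni'; have [cj' _] := sub' _ _ Nj'.
  have hJ := hE _ _ _ Ni Nj; have hJ' := hE' _ _ _ Ni' Nj'.
  (* Two routes in [c2] from [b i.1] to [b' j.2]: through [b j.1] and through [b' i.2]. *)
  have e1 := coc2 _ _ _ _ ci cj cj'; have e2 := coc2 _ _ _ _ ci ci' cj'.
  have E1 : cval (a i.1) (a j.1) x = h j.1 x - h i.1 x + cval (b i.1) (b j.1) x.
    by rewrite -hJ subrK.
  have E2 : cval (d i.2) (d j.2) x = cval (b' i.2) (b' j.2) x - (h' j.2 x - h' i.2 x).
    by rewrite -hJ' opprB addrC subrK.
  have E3 : cval (b i.1) (b j.1) x = cval (b i.1) (b' i.2) x
      + cval (b' i.2) (b' j.2) x - cval (b j.1) (b' j.2) x.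
    by rewrite e2 -e1 addrK.
  rewrite E1 E2 E3.
  move: (h j.1 x) (h i.1 x) (h' j.2 x) (h' i.2 x) (cval _ _ x) (cval _ _ x) (cval _ _ x).
  move=> u1 u2 u3 u4 u5 u6 u7; rewrite !opprD !opprK !addrA.
  by rewrite [LHS](ACl (1*7*5*2*8*3*(4*6))%AC) /= subrr addr0.
Qed.

End Cech.

(** * The bundle E, its exact sequence and its local splittings *)

Section Extension.
Local Open Scope ring_scope.
Variable k : closedFieldType.
Implicit Types x : P3 k.
Variables W V : vectType k.
Variables (A : vb_map (WOm1 W) (triv V)) (B : vb_map (triv V) (WdO1 W)).
Variables (F K : prebundle k) (phi : vb_map (cohom_vb A B) F) (f : vb_map (WOm1 W) K).

Lemma ext_AE x t : ext_A A f x t = (A x t, f x t).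
Proof. exact: (linfun_linE (pair_linear (A x) (f x))). Qed.

Lemma ext_BE x p : ext_B B K x p = B x p.1.
Proof. by rewrite linfun_linE // => a u v; rewrite -linearP. Qed.

Lemma ext_B_surj x : limg (B x) = fullv -> limg (ext_B B K x) = fullv.
Proof.
move=> /limg_fullP surj; apply/limg_fullP => t.
by have [v <-] := surj t; exists (v, 0); rewrite ext_BE.
Qed.

Lemma mem_lker_ext_B x p : (p \in lker (ext_B B K x)) = (p.1 \in lker (B x)).
Proof. by rewrite !memv_ker ext_BE. Qed.

Lemma limg_ext_AP x p :
  reflect (exists t, p = (A x t, f x t)) (p \in limg (ext_A A f x)).
Proof.
apply: (iffP memv_imgP) => [[t _ ->]|[t ->]].
  by exists t; rewrite ext_AE.
by exists t; rewrite ?memvf ?ext_AE.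
Qed.

Hypothesis complexAB : forall x, (limg (A x) <= lker (B x))%VS.

Lemma monad_mem x t : A x t \in lker (B x).
Proof. by apply: (subvP (complexAB x)); rewrite memv_img ?memvf. Qed.

Lemma ext_complex x : (limg (ext_A A f x) <= lker (ext_B B K x))%VS.
Proof.
by apply/subvP => p /limg_ext_AP[t ->]; rewrite mem_lker_ext_B monad_mem.
Qed.

Local Notation cls x := (sq_class (lker (B x)) (limg (A x))).
Local Notation ecls x := (sq_class (lker (ext_B B K x)) (limg (ext_A A f x))).

Lemma ext_iE x y : ext_i A B f x y = ecls x (0, y).
Proof.
rewrite linfun_linE // => a u v; rewrite -linearP.
by rewrite pair_linE scaler0 addr0.
Qed.

Lemma ext_p_repr x t : ext_p phi f x t = phi x (cls x (vsval t).1).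
Proof. by rewrite linfun_linE // => a u v; rewrite -!linearP. Qed.

(** Two representatives of a class differ by some [(A x t, f x t)], whose first component vanishes
    modulo the image of [A x]. *)
Lemma ext_pE x p : p.1 \in lker (B x) -> ext_p phi f x (ecls x p) = phi x (cls x p.1).
Proof.
move=> Bp; have Ep : p \in lker (ext_B B K x) by rewrite mem_lker_ext_B.
rewrite ext_p_repr; congr (phi x _); apply/eqP; rewrite sq_class_sub //.
  have /limg_ext_AP[t /(congr1 fst) /= ->] := sq_class_repr (ext_complex x) Ep.
  by rewrite memv_img ?memvf.
by rewrite -mem_lker_ext_B sq_vsval_mem.
Qed.

Lemma ext_E_ind x (P : ext_E A B f x -> Prop) :
  (forall p, p.1 \in lker (B x) -> P (ecls x p)) -> forall t, P t.
Proof.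
move=> Pp t; have [p] := sq_class_onto t; rewrite mem_lker_ext_B => Bp <-.
exact: Pp.
Qed.

Hypothesis injA : forall x, lker (A x) = 0%VS.

Lemma ext_i_inj x : lker (ext_i A B f x) = 0%VS.
Proof.
apply/lker_eq0P => y /eqP; rewrite ext_iE sq_class_eq0 ?ext_complex //; last first.
  by rewrite mem_lker_ext_B mem0v.
case/limg_ext_AP => t [At ->].
by have /lker_eq0P := injA x; move=> /(_ t (esym At)) ->; rewrite linear0.
Qed.

Hypothesis phiP : is_iso phi.

Let phi0 x : lker (phi x) = 0%VS. Proof. by case: phiP. Qed.
Let phiT x : limg (phi x) = fullv. Proof. by case: phiP. Qed.

Let phiK x u : (phi x)^-1%VF (phi x u) = u.
Proof. by apply: lker0_lfunK; rewrite phi0. Qed.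

Let phiVK x u : phi x ((phi x)^-1%VF u) = u.
Proof. by apply: limg_lfunVK; rewrite phiT memvf. Qed.

Lemma F_ind x (P : F x -> Prop) :
  (forall v, v \in lker (B x) -> P (phi x (cls x v))) -> forall u, P u.
Proof.
move=> Pv u; have [v Bv Ev] := sq_class_onto ((phi x)^-1%VF u).
by rewrite -[u]phiVK -Ev; apply: Pv.
Qed.

Lemma ext_p_surj x : limg (ext_p phi f x) = fullv.
Proof.
apply/limg_fullP; elim/F_ind => v Bv.
by exists (ecls x (v, 0)); rewrite ext_pE.
Qed.

Lemma ext_exact x : limg (ext_i A B f x) = lker (ext_p phi f x).
Proof.
apply/eqP; rewrite eqEsubv; apply/andP; split; apply/subvP => t.
  by case/memv_imgP => y _ ->; rewrite memv_ker ext_iE ext_pE ?mem0v //= !linear0.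
rewrite memv_ker; move: t; elim/ext_E_ind => p Bp; rewrite ext_pE // => /eqP.
have /lker_eq0P inj := phi0 x; move/inj/eqP; rewrite sq_class_eq0 //.
(* Here [p.1 = A x t], so subtracting [(A x t, f x t)] from [p] leaves a pair with first component
   zero. *)
case/memv_imgP => t _ Ep; apply/memv_imgP; exists (p.2 - f x t); rewrite ?memvf //.
apply/eqP; rewrite ext_iE sq_class_sub ?ext_complex ?mem_lker_ext_B ?mem0v //.
apply/limg_ext_AP; exists t; rewrite -Ep; case: p {Bp Ep} => v y /=.
by congr (_, _); rewrite ?subr0 //= opprB addrC subrK.
Qed.

Hypotheses (shF : sheafy F) (shK : sheafy K).

Lemma ext_i_morph : is_morph (ext_i A B f).
Proof.
move=> s x rs; exists (fun y => (0, s y) : dsum_vb (triv V) K y).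
  by split=> //=; apply: (reg0 (triv_sheafy V)).
by apply: near_all => y; rewrite mem_lker_ext_B mem0v ext_iE.
Qed.

Lemma ext_p_morph : is_morph (ext_p phi f).
Proof.
move=> s x [p [rp _] sp].
apply: (reg_near shF (s := fun y => phi y (cls y (p y).1))).
  by apply: (nearW _ sp) => y [Bp ->]; rewrite ext_pE // -mem_lker_ext_B.
have [mphi _ _ _] := phiP; apply: mphi; exists (fun y => (p y).1) => //.
by apply: (nearW _ sp) => y [Bp _]; rewrite -mem_lker_ext_B.
Qed.

(** The first condition says that replacing v by v + A t moves (v, g v) inside the image of [ext_A],
    and that adding (A t, f t) to (v, y) leaves y - g v unchanged: the section and the retraction
    descend to classes. The condition is imposed at one point so that it can be put under [near]. *)
Definition splitting (g : vb_map (triv V) K) x : Prop :=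
  (forall t, g x (A x t) = f x t) /\ @regular_at k (hom_vb (triv V) K) g x.

Definition split_section (g : vb_map (triv V) K) : vb_map F (ext_E A B f) :=
  fun x => linfun (fun u : F x =>
    let v := vsval ((phi x)^-1%VF u) in ecls x (v, g x v)).

Definition split_retract (g : vb_map (triv V) K) : vb_map (ext_E A B f) K :=
  fun x => linfun (fun t : ext_E A B f x => (vsval t).2 - g x (vsval t).1).

Section Splitting.
Variable g : vb_map (triv V) K.

Lemma split_sectionE x v : splitting g x -> v \in lker (B x) ->
  split_section g x (phi x (cls x v)) = ecls x (v, g x v).
Proof.
move=> [gA _] Bv.
have lrep : linear (fun u : F x => vsval ((phi x)^-1%VF u)).
  exact: comp_linear (@vsval_linear _ _ _) (@lfun_linear _ _ _ _).
rewrite (linfun_linE (graph_linear (ecls x) (g x) lrep)) /=.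
rewrite phiK; set w := vsval _; have Bw : w \in lker (B x) by apply: sq_vsval_mem.
apply/eqP; rewrite sq_class_sub ?ext_complex ?mem_lker_ext_B //.
have /memv_imgP[t _ wv] := sq_class_repr (complexAB x) Bv.
by apply/limg_ext_AP; exists t; rewrite -gA -wv linearB.
Qed.

Lemma split_retractE x p : splitting g x -> p.1 \in lker (B x) ->
  split_retract g x (ecls x p) = p.2 - g x p.1.
Proof.
move=> [gA _] Bp; rewrite (linfun_linE (retract_linear (g x) (@vsval_linear _ _ _))) /=.
have Ep : p \in lker (ext_B B K x) by rewrite mem_lker_ext_B.
have /limg_ext_AP[t] := sq_class_repr (ext_complex x) Ep.
case: (vsval _) => v y; case: p {Bp Ep} => v' y' /= [Ev Ey].
apply/eqP; rewrite -subr_eq0 opprD opprK addrACA Ey -gA -Ev linearB.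
by rewrite addrACA subrr addNr addr0.
Qed.

Lemma split_sectionK x u : splitting g x -> ext_p phi f x (split_section g x u) = u.
Proof.
by move=> gx; elim/F_ind: u => v Bv; rewrite split_sectionE // ext_pE.
Qed.

Lemma split_retractK x y : splitting g x -> split_retract g x (ext_i A B f x y) = y.
Proof.
by move=> gx; rewrite ext_iE split_retractE ?mem0v //= linear0 subr0.
Qed.

Lemma split_decomp x t : splitting g x ->
  t = ext_i A B f x (split_retract g x t) + split_section g x (ext_p phi f x t).
Proof.
move=> gx; elim/ext_E_ind: t => -[v y] Bv.
rewrite split_retractE // ext_pE // split_sectionE // ext_iE -linearD /=.
by congr (ecls x (_, _)); rewrite /= ?add0r ?subrK.
Qed.

Lemma split_section_regular x :
  near x (splitting g) -> @regular_at k (hom_vb F (ext_E A B f)) (split_section g) x.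
Proof.
(* Regularity of the inverse of [phi] supplies a regular [v], lying in Ker B near [x], that lifts
   [s]; the graph of [g] over [v] is then a regular lift to E. *)
move=> gx s rs; have [_ _ _ mphi] := phiP; have [v rv sv] := mphi s x rs.
exists (fun y => (v y, g y (v y)) : dsum_vb (triv V) K y).
  by split=> //=; have [_] := near_at gx; apply.
apply: (nearS gx sv) => y gy [Bv sy]; split; first by rewrite mem_lker_ext_B.
by rewrite -(phiVK (s y)) sy split_sectionE.
Qed.

Lemma split_retract_regular x :
  near x (splitting g) -> @regular_at k (hom_vb (ext_E A B f) K) (split_retract g) x.
Proof.
move=> gx s [p [rp1 rp2] sp].
apply: (reg_near shK (s := fun y => (p y).2 - g y (p y).1)).
  by apply: (nearS gx sp) => y gy [Bp ->]; rewrite split_retractE // -mem_lker_ext_B.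
by apply: regB => //; have [_] := near_at gx; apply.
Qed.

End Splitting.

Hypothesis local_splitting : forall x, exists g, near x (splitting g).

Lemma ext_E_vbundle r rK :
  is_vbundle r F -> is_vbundle rK K -> is_vbundle (rK + r) (ext_E A B f).
Proof.
move=> vbF vbK; apply: (locally_iso_vbundle (dsum_vbundle vbK vbF)) => x.
have [g gx] := local_splitting x.
exists (fun y => linfun (fun t : ext_E A B f y =>
  (split_retract g y t, ext_p phi f y t) : dsum_vb K F y)).
have tE y t : linfun (fun t : ext_E A B f y =>
    (split_retract g y t, ext_p phi f y t) : dsum_vb K F y) t =
  (split_retract g y t, ext_p phi f y t).
  exact: (linfun_linE (pair_linear (split_retract g y) (ext_p phi f y))).
have shE : sheafy (ext_E A B f) by apply/cohom_sheafy/dsum_sheafy/shK/triv_sheafy.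
apply: (nearW _ (near_near gx)) => y {}gx; have gy := near_at gx.
have pi0 w : ext_p phi f y (ext_i A B f y w) = 0.
  by apply/eqP; rewrite -memv_ker -ext_exact memv_img ?memvf.
have [t0 tT] := splitting_iso (fun w => split_retractK w gy)
  (fun u => split_sectionK u gy) pi0 (fun t => split_decomp t gy).
split=> //.
- move=> s; split=> [rs|].
    split; last first.
      by apply: (eq_reg shF _ (ext_p_morph rs)) => z; rewrite tE.
    by apply: (eq_reg shK _ (split_retract_regular gx rs)) => z; rewrite tE.
  move=> [r1 r2].
  have {}r1 : @regular_at k K (fun z => split_retract g z (s z)) y.
    by apply: (eq_reg shK _ r1) => z; rewrite tE.
  have {}r2 : @regular_at k F (fun z => ext_p phi f z (s z)) y.
    by apply: (eq_reg shF _ r2) => z; rewrite tE.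
  (* Conversely [s] is rebuilt from its two regular components by [split_decomp]. *)
  have := regD shE (ext_i_morph r1) (split_section_regular gx r2).
  apply: (reg_near shE); apply: (nearW _ gx) => z gz.
  by rewrite -split_decomp.
Qed.

End Extension.

(** * Contraction, cup product and the pairing through J *)

Section Products.
Local Open Scope ring_scope.
Variable k : closedFieldType.
Implicit Types x : P3 k.

Lemma triv_regular_fun (s : section (triv (k^o : vectType k))) x :
  regular_at s x -> regular_fun s x.
Proof.
move=> /(_ \1%VF); apply: eq_regular_fun.
by apply: near_all => y; rewrite id_lfunE.
Qed.

Lemma form_regular (V : vectType k) (J : 'Hom(V, lin_dual V))
    (a v : section (triv V)) x :
  regular_at a x -> regular_at v x -> regular_fun (fun y => J (a y) (v y)) x.
Proof.
move=> ra rv.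
(* Expanding the first argument in a fixed basis leaves products of linear forms applied to [a] and
   to [v], which are regular by definition of [triv]. *)
pose h (j : 'I_(\dim {:V})) y : k := dbas j (a y : V) * J (bas j) (v y).
have rh : regular_fun (fun y => \sum_j h j y) x.
  by apply: regular_sum => j; apply: regularM; [apply: ra | apply: rv].
apply: eq_regular_fun rh; apply: near_all => y.
rewrite [in RHS](bas_expand (a y : V)) linear_sum sum_lfunE.
by apply: eq_bigr => j _; rewrite linearZ scale_lfunE.
Qed.

Section Contraction.
Variable K : prebundle k.

Lemma contract_bilin x (l : Om1 k x) :
  bilin (fun (y : K x) (lam : O1 k x) => (lam l : k) *: y).
Proof.
split=> [lam a u v | y a lam mu] /=; first by rewrite scalerDr !scalerA mulrC.
by rewrite add_lfunE scale_lfunE scalerDl scalerA.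
Qed.

Lemma contract_linear x (s : tens_vb K (O1 k) x) : linear (contract s).
Proof.
move=> a u v; rewrite /contract /tlift scaler_sumr -big_split.
by apply: eq_bigr => j _ /=; rewrite linearP scalerDl scalerA.
Qed.

Hypothesis shK : sheafy K.

Lemma contract_regular (s : section (tens_vb K (O1 k))) (z : section (Om1 k)) x :
  regular_at s x -> regular_at z x ->
  @regular_at k K (fun y => contract (s y) (z y)) x.
Proof.
move=> rs rz; apply: (tlift_regular (G := K) (H := O1 k)
  (b := fun y (u : K y) (lam : O1 k y) => (lam (z y) : k) *: u)) => // [y|u lam ru rlam].
  exact: contract_bilin.
by apply: regZ => //; apply: triv_regular_fun; apply: rlam.
Qed.

Section Cup.
Variable F : prebundle k.
Hypothesis shF : sheafy F.
Variable s : section (tens_vb K (O1 k)).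
Hypothesis rs : global_section s.

Lemma cup_bilin x : bilin (fun (u : F x) (l : Om1 k x) => tns u (contract (s x) l)).
Proof.
by apply: (bilin_comp (tns_bilin _ _)) => //; apply: contract_linear.
Qed.

Lemma cup_reg_map : reg_map (G := tens_vb F (Om1 k)) (H := tens_vb F K)
  (fun x => tlift (fun u l => tns u (contract (s x) l))).
Proof.
split=> [x|t x rt]; first exact: tlift_linear (cup_bilin x).1.
apply: (tlift_regular (G := F) (H := Om1 k) (L := tens_vb F K)) rt.
- exact: tens_sheafy.
- exact: cup_bilin.
- by move=> u v ru rv; apply: tns_regular => //; apply: contract_regular.
Qed.

End Cup.

Section TensToHom.
Variables (F : prebundle k) (q : vb_map F (dual_vb F)).

Lemma rank1E x u y (u' : F x) :
  linfun (fun u' : F x => (q x u u' : k) *: (y : K x)) u' = (q x u u' : k) *: y.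
Proof. by rewrite linfun_linE // => a v w; rewrite linearP scalerDl scalerA. Qed.

Lemma tens_to_hom_bilin x : bilin (fun (u : F x) (y : K x) =>
  linfun (fun u' : F x => (q x u u' : k) *: y)).
Proof.
split=> [y a u v | u a y z]; apply/lfunP => u';
  rewrite add_lfunE scale_lfunE !rank1E.
  by rewrite linearP add_lfunE scale_lfunE scalerDl scalerA.
by rewrite scalerDr !scalerA mulrC.
Qed.

Lemma tens_to_hom_linear x : linear (@tens_to_hom k F K q x).
Proof. exact: tlift_linear (tens_to_hom_bilin x).1. Qed.

Lemma tens_to_hom_tns x (u u' : F x) (y : K x) :
  (tens_to_hom q (tns u y : tens_vb F K x) : 'Hom(F x, K x)) u' = (q x u u' : k) *: y.
Proof. by rewrite /tens_to_hom tliftE ?rank1E //; apply: tens_to_hom_bilin. Qed.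

Lemma tens_to_hom_reg_map : is_morph q -> reg_map (@tens_to_hom k F K q).
Proof.
move=> mq; split=> [x|t x rt]; first exact: tens_to_hom_linear.
apply: (tlift_regular (G := F) (H := K) (L := hom_vb F K)) rt.
- exact: hom_sheafy.
- exact: tens_to_hom_bilin.
move=> u v ru rv s rs.
apply: (eq_reg shK (s := fun y => (q y (u y) (s y) : k) *: v y)).
  by move=> y; rewrite rank1E.
by apply: regZ => //; apply: triv_regular_fun; apply: mq rs.
Qed.

End TensToHom.

Section Pairing.
Variables (V : vectType k) (J : 'Hom(V, lin_dual V)).

(* For a local lift T of xi_l this is the l-th summand of g_i(v). *)
Definition pairing x (s : tens_vb K (O1 k) x) (T : tens V (Om1 k x)) (v : V) : K x :=
  tlift (fun (a : V) (z : Om1 k x) => (J a v : k) *: contract s z) T.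

Lemma pairing_bilin x (s : tens_vb K (O1 k) x) (v : V) :
  bilin (fun (a : V) (z : Om1 k x) => (J a v : k) *: contract s z).
Proof.
split=> [z a u w | u a z z'] /=.
  by rewrite linearP add_lfunE scale_lfunE scalerDl scalerA.
by rewrite contract_linear scalerDr !scalerA mulrC.
Qed.

Lemma pairing_linearl x s v : linear (@pairing x s ^~ v).
Proof. exact: tlift_linear (pairing_bilin s v).1. Qed.

Lemma pairing_tns x s a z v : @pairing x s (tns a z) v = (J a v : k) *: contract s z.
Proof. by rewrite /pairing tliftE //; apply: pairing_bilin. Qed.

Lemma pairing_linearr x s T : linear (@pairing x s T).
Proof.
move=> a u v; rewrite /pairing /tlift scaler_sumr -big_split.
by apply: eq_bigr => j _ /=; rewrite linearP scalerDl scalerA.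
Qed.

Lemma pairing_regular (s : section (tens_vb K (O1 k)))
    (T : section (tens_vb (triv V) (Om1 k))) (v : section (triv V)) x :
  regular_at s x -> regular_at T x -> regular_at v x ->
  @regular_at k K (fun y => pairing (s y) (T y) (v y)) x.
Proof.
move=> rs rT rv; apply: (tlift_regular (G := triv V) (H := Om1 k)
  (b := fun y (a : V) (z : Om1 k y) => (J a (v y) : k) *: contract (s y) z)) rT => //.
  by move=> y; apply: pairing_bilin.
by move=> a z ra rz; apply: regZ => //; [apply: form_regular | apply: contract_regular].
Qed.

End Pairing.
End Contraction.

(** * The pairing on Ker B and on lifts of sections of W^* (x) O *)

Section MonadPairing.
Variables W V : vectType k.
Variables (A : vb_map (WOm1 W) (triv V)) (B : vb_map (triv V) (WdO1 W)).
Variables (F K : prebundle k) (phi : vb_map (cohom_vb A B) F).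
Variables (J : 'Hom(V, lin_dual V)) (q : vb_map F (dual_vb F)).

Lemma ker_proj_linear x : linear (@ker_proj k W V A B F phi x).
Proof. by move=> a u v; rewrite /ker_proj !linearP. Qed.

Lemma ker_proj_reg_map : is_morph phi -> sheafy F ->
  reg_map (G := tens_vb (ker_vb B) (Om1 k)) (H := tens_vb F (Om1 k))
    (fun x => tmap (@ker_proj k W V A B F phi x) id).
Proof.
move=> mphi shF; split=> [x|t x rt]; first exact: tmap_linear (@ker_proj_linear x).
apply: (tlift_regular (G := ker_vb B) (H := Om1 k) (L := tens_vb F (Om1 k))) rt.
- exact: tens_sheafy.
- by move=> y; apply: (bilin_comp (tns_bilin _ _)) => //; apply: ker_proj_linear.
move=> u v ru rv; apply: tns_regular => //.
apply: (mphi (fun y => sq_class (lker (B y)) (limg (A y)) (vsval (u y)))).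
exists (fun y => vsval (u y)) => //.
by apply: near_all => y; split=> //; apply: subvsP.
Qed.

Hypothesis qJ : forall x (u v : ker_vb B x),
  q x (ker_proj phi u) (ker_proj phi v) = J (vsval u) (vsval v).

(** Translates the cup product on F into J on V. Both sides are linear in [T], and on pure tensors
    the equality is [qJ]. *)
Lemma tens_to_hom_pairing x (s : tens_vb K (O1 k) x)
    (T : tens (ker_vb B x) (Om1 k x)) (v : ker_vb B x) :
  (tens_to_hom q (tlift (fun (u : F x) l => tns u (contract s l))
     (tmap (@ker_proj k W V A B F phi x) id T) : tens_vb F K x) : 'Hom(F x, K x))
    (ker_proj phi v)
  = pairing J s (tmap (fun u : ker_vb B x => vsval u : V) id T) (vsval v).
Proof.
have cb : bilin (fun (u : F x) (l : Om1 k x) => tns u (contract s l)).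
  by apply: (bilin_comp (tns_bilin _ _)) => //; apply: contract_linear.
pose h T := (tens_to_hom q (tlift (fun (u : F x) l => tns u (contract s l))
     (tmap (@ker_proj k W V A B F phi x) id T) : tens_vb F K x) : 'Hom(F x, K x)).
apply: (tens_ext (g := fun T => h T (ker_proj phi v)) (h := fun T =>
   pairing J s (tmap (fun u : ker_vb B x => vsval u : V) id T) (vsval v))).
- move=> a T1 T2; rewrite /h (tmap_linear _ (@ker_proj_linear x)) (tlift_linear cb.1).
  by rewrite tens_to_hom_linear add_lfunE scale_lfunE.
- move=> a T1 T2; rewrite (tmap_linear _ (@vsval_linear _ _ _)).
  exact: pairing_linearl.
move=> u z; rewrite /h tmap_tns //; last exact: ker_proj_linear.
by rewrite tliftE // tens_to_hom_tns qJ tmap_tns ?pairing_tns //; apply: vsval_linear.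
Qed.

Lemma tens_to_hom_pairing_sum x m (s : 'I_m -> tens_vb K (O1 k) x)
    (T : 'I_m -> tens (ker_vb B x) (Om1 k x)) (v : V) :
  v \in lker (B x) ->
  (tens_to_hom q (\sum_l tlift (fun (u : F x) z => tns u (contract (s l) z))
     (tmap (@ker_proj k W V A B F phi x) id (T l)) : tens_vb F K x) : 'Hom(F x, K x))
    (phi x (sq_class (lker (B x)) (limg (A x)) v))
  = \sum_l pairing J (s l) (tmap (fun u : ker_vb B x => vsval u : V) id (T l)) v.
Proof.
move=> Bv; rewrite (lin_sum (@tens_to_hom_linear _ _ _ x)) sum_lfunE.
apply: eq_bigr => l _; have := tens_to_hom_pairing (s l) (T l) (vsproj (lker (B x)) v).
by rewrite {2}/ker_proj vsprojK.
Qed.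

Hypothesis adj : is_adjoint J A B.

(** By adjunction the left-hand side depends on [T] only through its image under B: it is [psi],
    which evaluates the W^* (x) O(1) factor at [tns w z] and contracts the remaining O(-1) factor
    with [s]. *)
Lemma pairing_lift x (s : tens_vb K (O1 k) x) (T : tens V (Om1 k x))
    (xi : lin_dual W) (w : W) (z : Om1 k x) :
  tmap (B x) id T = dual_section xi x ->
  pairing J s T (A x (tns w z)) = (xi w : k) *: contract s z.
Proof.
pose ev_wz (beta : WdO1 W x) : k := tlift (fun (xi : lin_dual W) (lam : O1 k x) =>
  xi w * lam z : k^o) beta.
have evb : bilin (fun (xi : lin_dual W) (lam : O1 k x) => xi w * lam z : k^o).
  split=> [lam a u v | u a lam mu] /=; rewrite add_lfunE scale_lfunE.
    by rewrite mulrDl -mulrA.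
  by rewrite mulrDr mulrCA.
have evl : linear (ev_wz : _ -> k^o) := tlift_linear evb.1.
have psib : bilin (fun (beta : WdO1 W x) (z' : Om1 k x) => ev_wz beta *: contract s z').
  split=> [z' a u v | u a u' v'] /=; first by rewrite evl scalerDl scalerA.
  by rewrite contract_linear scalerDr !scalerA mulrC.
pose psi := tlift (fun (beta : WdO1 W x) (z' : Om1 k x) => ev_wz beta *: contract s z').
have psil : linear psi := tlift_linear psib.1.
have -> : pairing J s T (A x (tns w z)) = psi (tmap (B x) id T).
  apply: (tens_ext (g := fun T => pairing J s T (A x (tns w z)))
    (h := fun T => psi (tmap (B x) id T))) => [||a z'].
  - exact: pairing_linearl.
  - by move=> a T1 T2; rewrite (tmap_linear _ (@lfun_linear _ _ _ (B x))) psil.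
  rewrite pairing_tns tmap_tns //; last exact: lfun_linear.
  by rewrite /psi tliftE // /ev_wz adj.
move=> ->; rewrite /dual_section (lin_sum psil).
(* [dual_section xi] carries the identity of O(-1) as a sum over dual bases, so the contraction
   returns [z] itself. *)
rewrite [z in RHS](bas_expand z) (lin_sum (@contract_linear _ _ s)) scaler_sumr.
apply: eq_bigr => j _; rewrite (linZ (@contract_linear _ _ s)) scalerA.
by rewrite /psi tliftE // /ev_wz tliftE.
Qed.

End MonadPairing.
End Products.

(** * The cocycle of the extension *)

Section ExtensionClass.
Local Open Scope ring_scope.
Variable k : closedFieldType.
Implicit Types x : P3 k.
Variables W V : vectType k.
Variables (A : vb_map (WOm1 W) (triv V)) (B : vb_map (triv V) (WdO1 W)).
Variables (F K : prebundle k) (phi : vb_map (cohom_vb A B) F) (f : vb_map (WOm1 W) K).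
Variables (J : 'Hom(V, lin_dual V)) (q : vb_map F (dual_vb F)).

Hypothesis complexAB : forall x, (limg (A x) <= lker (B x))%VS.
Hypotheses (phiP : is_iso phi) (mq : is_morph q).
Hypotheses (shF : sheafy F) (shK : sheafy K).
Hypothesis qJ : forall x (u v : ker_vb B x),
  q x (ker_proj phi u) (ker_proj phi v) = J (vsval u) (vsval v).
Hypothesis adj : is_adjoint J A B.

Variables (m : nat) (xi : 'I_m -> lin_dual W).
Variable s : 'I_m -> section (tens_vb K (O1 k)).
Hypothesis rs : forall l, global_section (s l).
Hypothesis fE : forall x (w : W) (z : Om1 k x),
  f x (tns w z) = \sum_l (xi l w : k) *: contract (s l x) z.

Variable c : 'I_m -> cochain (tens_vb (ker_vb B) (Om1 k)).
Hypothesis coc : forall l, is_cocycle (c l).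
Variable T : forall l, idx (c l) -> section (tens_vb (triv V) (Om1 k)).
Hypothesis T_lift : forall l i x, cov i x ->
  regular_at (T (l := l) i) x /\ tmap (B x) id (T i x) = dual_section (xi l) x.
Hypothesis T_diff : forall l i j x, cov i x -> cov j x ->
  tmap (fun v : ker_vb B x => vsval v : V) id (cval (c := c l) i j x) = T j x - T i x.

Definition lift_map (i : forall l, idx (c l)) : vb_map (triv V) K :=
  fun x => linfun (fun v : V => \sum_l pairing J (s l x) (T (i l) x) v).

Lemma lift_mapE i x v : lift_map i x v = \sum_l pairing J (s l x) (T (i l) x) v.
Proof. by rewrite linfun_linE //; apply: sum_linear => l; apply: pairing_linearr. Qed.

Lemma lift_map_diff i j x v : (forall l, cov (i l) x) -> (forall l, cov (j l) x) ->
  lift_map j x v - lift_map i x v = \sum_l pairing J (s l x)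
    (tmap (fun u : ker_vb B x => vsval u : V) id (cval (c := c l) (i l) (j l) x)) v.
Proof.
move=> ci cj; rewrite !lift_mapE -sumrB; apply: eq_bigr => l _.
by rewrite (T_diff (ci l) (cj l)) (linB (@pairing_linearl _ _ _ _ _ _ v)).
Qed.

Lemma lift_map_splitting i x :
  (forall l, cov (i l) x) -> splitting A f (lift_map i) x.
Proof.
move=> ci; split=> [|v rv].
  apply: tens_ext; [|exact: lfun_linear|move=> w z].
    by apply: (comp_linear (g := lift_map i x)); apply: lfun_linear.
  rewrite lift_mapE fE; apply: eq_bigr => l _.
  by apply: (pairing_lift adj); have [] := T_lift (ci l).
apply: (eq_reg shK (s := fun y => \sum_l pairing J (s l y) (T (i l) y) (v y))).
  by move=> y; rewrite lift_mapE.
apply: reg_sum => // l; apply: pairing_regular => //; first exact: rs.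
by have [] := T_lift (ci l).
Qed.

Lemma lift_cover : is_cover (fun (i : forall l, idx (c l)) x => forall l, cov (i l) x).
Proof. by apply: (sum_cover (N := fun l => @cov _ _ (c l))) => l; case: (coc l). Qed.

Lemma lift_local_splitting x : exists g, near x (splitting A f g).
Proof.
have [oc ac] := lift_cover; have [i ci] := ac x.
by exists (lift_map i); apply: near_open (oc i) ci _ => y; apply: lift_map_splitting.
Qed.

(** The cup product formed with the representative of the class of [xi l] that comes from the lifts
    [T]; it stands in for the given one, to which it is only cohomologous. *)
Let cupF l := cup (push (G := tens_vb (ker_vb B) (Om1 k)) (H := tens_vb F (Om1 k))
  (fun x => tmap (@ker_proj k W V A B F phi x) id) (c l)) (s l).

Let mphi : is_morph phi. Proof. by case: phiP. Qed.

Lemma cupF_cocycle l : is_cocycle (cupF l).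
Proof.
apply: push_cocycle; first exact: cup_reg_map.
by apply: push_cocycle; first exact: ker_proj_reg_map.
Qed.

Lemma lift_connecting :
  @connecting k (hom_vb F K) (hom_vb F (ext_E A B f)) (hom_vb F F)
    (fun x g => (ext_i A B f x \o g)%VF) (fun x g => (ext_p phi f x \o g)%VF)
    (fun x => \1%VF) (push (tens_to_hom q (K := K)) (sum_cochain cupF)).
Proof.
split.
  apply: push_cocycle; first exact: tens_to_hom_reg_map.
  by apply: sum_cocycle; [apply: tens_sheafy | apply: cupF_cocycle].
(* [sum_cochain cupF] is indexed by the same tuples as [lift_map], so the local splittings fit its
   cover without refinement. *)
exists (fun i : forall l, idx (c l) => split_section phi f (lift_map i)); split.
  move=> i x ci; split.
    apply: split_section_regular => //.
    by apply: near_open (lift_cover.1 i) ci _ => y; apply: lift_map_splitting.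
  apply/lfunP => u; rewrite comp_lfunE id_lfunE split_sectionK //.
  exact: lift_map_splitting.
move=> i j x ci cj; have gi := lift_map_splitting ci; have gj := lift_map_splitting cj.
apply/lfunP => u; rewrite comp_lfunE add_lfunE opp_lfunE.
elim/(F_ind phiP): u => v Bv.
rewrite !split_sectionE // ext_iE -linearB; congr (sq_class _ _ _).
have pE (u u' : V) (y y' : K x) : (u, y) - (u', y') = (u - u', y - y') by [].
rewrite pE subrr lift_map_diff //; congr (_, _).
exact: (tens_to_hom_pairing_sum qJ (fun l => s l x)
  (fun l => cval (c := c l) (i l) (j l) x) Bv).
Qed.

End ExtensionClass.

(** The argument is purely algebraic and is carried out over any algebraically closed field. *)
Lemma monad_extension (k : closedFieldType) (n r rK : nat) (ty : form_type)
    (F : prebundle k) (q : vb_map F (dual_vb F))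
    (W V : vectType k) (J : 'Hom(V, lin_dual V))
    (A : vb_map (WOm1 W) (triv V)) (B : vb_map (triv V) (WdO1 W))
    (phi : vb_map (cohom_vb A B) F)
    (K : prebundle k) (f : vb_map (WOm1 W) K) (e : cochain (tens_vb F K)) :
  is_vbundle r F -> is_morph q ->
  instanton_monad phi n r ty q J ->
  is_vbundle rK K ->
  is_morph f ->
  is_cocycle e ->
  canonical_image phi f e ->
  [/\ is_monad (ext_A A f) (ext_B B K),
      exists rE, is_vbundle rE (ext_E A B f),
      short_exact (ext_i A B f) (ext_p phi f) &
      ext_class (ext_i A B f) (ext_p phi f) (push (tens_to_hom q (K := K)) e)].
Proof.
move=> vbF mq [_ _ [[[vb1 [rV vbV] vb2] mA mB AB [injA surjB]] adj] phiP qJ] vbK mf coce.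
case=> m [xi [s [h [rs fE hxi e_h]]]].
have shF := vbundle_sheafy vbF; have shK := vbundle_sheafy vbK.
have coch l : is_cocycle (h l) by case: (hxi l).
(* Finite choice over [l] extracts the cocycles in Ker B (-1), and just below their lifts to V (-1),
   from the existential statements. *)
have {hxi}/fin_all_exists[c hc] : forall l, exists c : cochain (tens_vb (ker_vb B) (Om1 k)),
    @connecting k (tens_vb (ker_vb B) (Om1 k)) (tens_vb (triv V) (Om1 k))
      (tens_vb (WdO1 W) (Om1 k)) (fun x => tmap (fun v => vsval v) id)
      (fun x => tmap (B x) id) (dual_section (xi l)) c /\
    cohomologous (h l) (push (G := tens_vb (ker_vb B) (Om1 k)) (H := tens_vb F (Om1 k))
         (fun x => tmap (@ker_proj k W V A B F phi x) id) c).
  by move=> l; have [_ [c c1 c2]] := hxi l; exists c.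
have [T hT] := fin_all_exists (fun l => (hc l).1.2).
have cocc l : is_cocycle (c l) := (hc l).1.1.
have T_lift l := (hT l).1; have T_diff l := (hT l).2.
have mphi : is_morph phi by case: phiP.
have splits x : exists g, near x (splitting A f g).
  exact: (lift_local_splitting shK adj rs fE cocc T_lift).
split.
- split=> //.
  + by split=> //; exists (rV + rK)%N; apply: dsum_vbundle.
  + move=> t x rt; split.
      by apply: (eq_reg (triv_sheafy V) _ (mA t x rt)) => y; rewrite ext_AE.
    by apply: (eq_reg shK _ (mf t x rt)) => y; rewrite ext_AE.
  + move=> t x [rt _].
    by apply: (eq_reg (tens_sheafy _ (triv_sheafy _)) _ (mB _ x rt)) => y; rewrite ext_BE.
  + exact: ext_complex.
  + split=> x; last exact: ext_B_surj.
    apply/lker_eq0P => t; rewrite ext_AE => -[At _].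
    by have /lker_eq0P := injA x; apply.
- by exists (rK + r)%N; exact: (ext_E_vbundle AB phiP shF shK splits).
- split; [exact: ext_i_morph | exact: ext_p_morph | exact: ext_i_inj
    | exact: ext_p_surj | exact: ext_exact].
have con := lift_connecting AB phiP mq shF shK qJ adj rs fE cocc T_lift T_diff.
exists (push (tens_to_hom q (K := K)) (sum_cochain (fun l => cup (push
  (G := tens_vb (ker_vb B) (Om1 k)) (H := tens_vb F (Om1 k))
  (fun x => tmap (@ker_proj k W V A B F phi x) id) (c l)) (s l)))) => //.
apply: push_cohomologous; first exact: tens_to_hom_reg_map.
have shFK := tens_sheafy K shF.
(* The middle term is the sum of the cup products with the given [h l]; each [h l] is then replaced
   by the push-forward of [c l]. *)
apply: cohomologous_trans e_h _ => //.
  by apply: sum_cocycle => // l; apply: push_cocycle => //; apply: cup_reg_map.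
apply: sum_cohomologous => // l; apply: push_cohomologous; first exact: cup_reg_map.
by have [] := hc l.
Qed.

Theorem lemma3p2 (R : realType) (n r rK : nat) (ty : form_type)
    (F : prebundle R[i]) (q : vb_map F (dual_vb F))
    (W V : vectType R[i]) (J : 'Hom(V, lin_dual V))
    (A : vb_map (WOm1 W) (triv V)) (B : vb_map (triv V) (WdO1 W))
    (phi : vb_map (cohom_vb A B) F)
    (K : prebundle R[i]) (f : vb_map (WOm1 W) K) (e : cochain (tens_vb F K)) :
  is_instanton r ty q ->
  instanton_monad phi n r ty q J ->
  is_vbundle rK K ->
  is_morph f ->
  is_cocycle e ->
  canonical_image phi f e ->
  [/\ is_monad (ext_A A f) (ext_B B K),
      exists rE, is_vbundle rE (ext_E A B f),
      short_exact (ext_i A B f) (ext_p phi f) &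
      ext_class (ext_i A B f) (ext_p phi f) (push (tens_to_hom q (K := K)) e)].
Proof. by move=> [vbF [[mq _ _ _] _] _ _]; apply: monad_extension. Qed.
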